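(* Let $\langle W, < \rangle$ be a strict linear order containing an infinite ascending chain of pairwise distinct elements of $W$. Let $\leqslant$ be the reflexive closure of $<$ and $R$ a binary relation on $W$ with ${<}\subseteq R\subseteq{\leqslant}$. Let $L$ be a logic (set of formulas) such that $\mathbf{L}(W, R) \subseteq L \subseteq \mathbf{L}_{c}(W, R)$. Then satisfiability for $L$ is $\Pi^0_1$-hard—hence $L$ is $\Sigma^0_1$-hard—in languages with two individual variables, one monadic predicate letter and one proposition letter; that is, the set of formulas $\varphi$ containing only two individual variables, a single monadic predicate letter and a single proposition letter with $\neg\varphi\notin L$ is $\Pi^0_1$-hard, and the set of such formulas belonging to $L$ is $\Sigma^0_1$-hard.
   Context: First-order (predicate) modal language: countably many individual variables, predicate letters of every arity (nullary ones are proposition letters), no constants or function symbols, $\bot$, $\to$, $\Box$, $\forall$; other connectives, $\exists$, $\Diamond$ defined as usual. A predicate frame with expanding domains over a Kripke frame $\langle W,R\rangle$ is $\langle W,R,D\rangle$ with non-empty sets $D_w$ such that $wRw'$ implies $D_w\subseteq D_{w'}$; constant domain if all $D_w$ coincide. A model adds $I(w,P)\subseteq D_w^n$ for each $n$-ary letter $P$. Truth: atoms via $I(w,\cdot)$; Boolean connectives classically; $w\models^g\Box\varphi$ iff $v\models^g\varphi$ for all $R$-successors $v$ of $w$; $w\models^g\forall x\,\varphi$ iff $w\models^{g'}\varphi$ for all $x$-variants $g'$ of $g$ with $g'(x)\in D_w$. A formula is true at $w$ if true under all assignments sending its free variables into $D_w$. $\mathbf{L}(W,R)$ (resp. $\mathbf{L}_c(W,R)$)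 is the set of formulas true at all worlds of all models based on predicate frames with expanding (resp. constant) domains over $\langle W,R\rangle$. Satisfiability for $L$ is the set of $\varphi$ with $\neg\varphi\notin L$. *)

(* Defs.v *)
From mathcomp Require Import all_boot.

Set Implicit Arguments.
Unset Strict Implicit.
Unset Printing Implicit Defensive.

(* Individual variables are natural numbers; [Atom k a], with [a] an [n]-tuple
   of variables, applies the [k]-th predicate letter of arity [n], so that
   [Atom k [tuple]] is a proposition letter. *)
Inductive form : Type :=
  | Bot
  | Atom (n k : nat) (a : n.-tuple nat)
  | Imp (A B : form)
  | Box (A : form)
  | All (x : nat) (A : form).

Definition Neg (A : form) : form := Imp A Bot.

Fixpoint free_vars (A : form) : seq nat :=
  match A with
  | Bot => [::]
  | Atom _ _ a => a
  | Imp B C => free_vars B ++ free_vars C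
  | Box B => free_vars B
  | All x B => [seq z <- free_vars B | z != x]
  end.

(* Unlike [free_vars], includes bound and merely quantified variables. *)
Fixpoint vars (A : form) : seq nat :=
  match A with
  | Bot => [::]
  | Atom _ _ a => a
  | Imp B C => vars B ++ vars C
  | Box B => vars B
  | All x B => x :: vars B
  end.

(* A letter is given as the pair (arity, index). *)
Fixpoint letters (A : form) : seq (nat * nat) :=
  match A with
  | Bot => [::]
  | Atom n k _ => [:: (n, k)]
  | Imp B C => letters B ++ letters C
  | Box B => letters B
  | All _ B => letters B
  end.

(* [vars] and [letters] collect what occurs in [A], so the language has at
   most the variables [x], [y], the [P]-th monadic letter and the [p]-th
   proposition letter. *)
Definition in_fragment (x y P p : nat) (A : form) : Prop :=
  {subset vars A <= [:: x; y]} /\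
  {subset letters A <= [:: (1, P); (0, p)]}.

(* The local domains are subsets of an ambient type [carrier]. *)
Record pred_frame (W : Type) (R : W -> W -> Prop) : Type := PredFrame {
  carrier : Type;
  dom : W -> carrier -> Prop;
  dom_nonempty : forall w, exists d, dom w d;
  dom_expanding : forall w v, R w v -> forall d, dom w d -> dom v d
}.
Arguments dom {W R} _ _ _.

Definition constant_domain (W : Type) (R : W -> W -> Prop)
    (F : pred_frame R) : Prop :=
  forall w v d, dom F w d <-> dom F v d.

Record interpretation (W : Type) (R : W -> W -> Prop)
    (F : pred_frame R) : Type := Interpretation {
  holds : forall (w : W) (n k : nat), n.-tuple (carrier F) -> Prop;
  holds_dom : forall w n k (a : n.-tuple (carrier F)),
    holds w k a -> forall i : 'I_n, dom F w (tnth a i)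
}.
Arguments holds {W R F} _ _ {n} _ _.

Fixpoint sat (W : Type) (R : W -> W -> Prop) (F : pred_frame R)
    (I : interpretation F) (w : W) (g : nat -> carrier F) (A : form)
    {struct A} : Prop :=
  match A with
  | Bot => False
  | Atom n k a => holds I w k (map_tuple g a)
  | Imp B C => sat I w g B -> sat I w g C
  | Box B => forall v, R w v -> sat I v g B
  | All x B => forall g' : nat -> carrier F,
      (forall z, z <> x -> g' z = g z) -> dom F w (g' x) -> sat I w g' B
  end.

Definition true_at (W : Type) (R : W -> W -> Prop) (F : pred_frame R)
    (I : interpretation F) (w : W) (A : form) : Prop :=
  forall g : nat -> carrier F,
    (forall z, z \in free_vars A -> dom F w (g z)) -> sat I w g A.

Definition logic_exp (W : Type) (R : W -> W -> Prop) (A : form) : Prop :=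
  forall (F : pred_frame R) (I : interpretation F) (w : W), true_at I w A.

Definition logic_const (W : Type) (R : W -> W -> Prop) (A : form) : Prop :=
  forall F : pred_frame R, constant_domain F ->
  forall (I : interpretation F) (w : W), true_at I w A.

Definition satisfiable_for (L : form -> Prop) (A : form) : Prop :=
  ~ L (Neg A).

Definition strict_linear_order (W : Type) (lt : W -> W -> Prop) : Prop :=
  [/\ forall u, ~ lt u u,
      forall u v w, lt u v -> lt v w -> lt u w
    & forall u v, [\/ lt u v, u = v | lt v u] ].

(* Definitions of [k]-ary partial recursive functions. *)
Inductive recfun : nat -> Type :=
  | RZero k : recfun k
  | RSucc : recfun 1
  | RProj k (i : 'I_k) : recfun k
  | RComp k m (f : recfun m) (h : 'I_m -> recfun k) : recfun k
  | RPrim k (f : recfun k) (h : recfun k.+2) : recfun k.+1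
  | RMin k (f : recfun k.+1) : recfun k.

(* [computes r v y]: the partial function defined by [r] is defined at [v],
   with value [y].  In [RPrim] the recursion argument comes first and [s] is
   the course of values; in [RMin] all values before the first zero must be
   defined. *)
Fixpoint computes (k : nat) (r : recfun k) : k.-tuple nat -> nat -> Prop :=
  match r in recfun k return k.-tuple nat -> nat -> Prop with
  | RZero _ => fun _ y => y = 0
  | RSucc => fun v y => y = (thead v).+1
  | RProj _ i => fun v y => y = tnth v i
  | RComp _ m f h => fun v y =>
      exists w : m.-tuple nat,
        (forall i, computes (h i) v (tnth w i)) /\ computes f w y
  | RPrim _ f h => fun v y =>
      exists s : nat -> nat,
        [/\ computes f [tuple of behead v] (s 0),
            forall i, i < thead v ->
              computes h [tuple of i :: s i :: behead v] (s i.+1)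
          & y = s (thead v)]
  | RMin _ f => fun v y =>
      computes f [tuple of y :: v] 0 /\
      (forall i, i < y -> exists z, computes f [tuple of i :: v] z.+1)
  end.

Definition recursive_fun (f : nat -> nat) : Prop :=
  exists r : recfun 1, forall n, computes r [tuple n] (f n).

Definition recursive_rel (Q : nat -> nat -> bool) : Prop :=
  exists r : recfun 2, forall n m, computes r [tuple n; m] (nat_of_bool (Q n m)).

Definition Sigma1 (X : nat -> Prop) : Prop :=
  exists2 Q : nat -> nat -> bool,
    recursive_rel Q & forall n, X n <-> exists m, Q n m.

Definition Pi1 (X : nat -> Prop) : Prop :=
  exists2 Q : nat -> nat -> bool,
    recursive_rel Q & forall n, X n <-> forall m, Q n m.

(* Goedel numbering, based on the effective bijection
   [CodeSeq.code : seq nat -> nat]. *)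
Fixpoint godel (A : form) : nat :=
  match A with
  | Bot => CodeSeq.code [:: 0]
  | Atom _ k a => CodeSeq.code [:: 1, k & a]
  | Imp B C => CodeSeq.code [:: 2; godel B; godel C]
  | Box B => CodeSeq.code [:: 3; godel B]
  | All x B => CodeSeq.code [:: 4; x; godel B]
  end.

Lemma godel_inj : injective godel.
Proof.
have cI s t : CodeSeq.code s = CodeSeq.code t -> s = t.
  exact: (can_inj CodeSeq.codeK).
elim=> [|n k a|B IHB C IHC|B IHB|x B IHB] [|n' k' a'|B' C'|B'|x' B'] eqAB //;
  have {eqAB} := cI _ _ eqAB => //.
- case=> <- eq_a.
  have eq_n : n = n' by rewrite -(size_tuple a) eq_a size_tuple.
  move: a' eq_a; rewrite -eq_n => a' eq_a.
  by congr Atom; apply: val_inj.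
- by case=> /IHB-> /IHC->.
- by case=> /IHB->.
- by case=> -> /IHB->.
Qed.

Definition many_one_reducible (X : nat -> Prop) (S : form -> Prop) : Prop :=
  exists f : nat -> form,
    recursive_fun (fun n => godel (f n)) /\ (forall n, X n <-> S (f n)).

Definition Sigma1_hard (S : form -> Prop) : Prop :=
  forall X : nat -> Prop, Sigma1 X -> many_one_reducible X S.

Definition Pi1_hard (S : form -> Prop) : Prop :=
  forall X : nat -> Prop, Pi1 X -> many_one_reducible X S.

(* Main.v *)
Require Import Defs.
From HB Require Import structures.
From mathcomp Require Import all_boot zify.
From Stdlib Require Import Classical FunctionalExtensionality Setoid.

Set Implicit Arguments.
Unset Strict Implicit.
Unset Printing Implicit Defensive.

(** A nondeterministic counter program searches for a witness of
    [exists m, Q n m]; a formula is written that is satisfiable exactly if the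
    program has no terminating run on input [n].  Everything is evaluated at a
    root world.  A domain element stands for a configuration: the control state
    and the registers are read off the future worlds at which the letter [P]
    holds of it.  Worlds are classified by closed formulas (tags), one for each
    state and each register; the value of a register is the number of worlds
    with its tag at which [P] holds of the element, worlds not separated by a
    marker world (where [p] holds) being counted once.  That two elements have
    equal values of a register, or values differing by one, is then a box
    formula in two variables, and a transition of the program becomes
    [forall x, guard x -> exists y, update x y].
    In any model, with expanding domains, the elements simulate every run of the
    program.  Conversely, if no run terminates, the configurations from which
    the program cannot terminate form the constant domain of a model, together
    with special elements that make the tags definable. *)

(** * Counter programs *)

Definition upd (T : Type) (g : nat -> T) (i : nat) (d : T) : nat -> T :=
  fun z => if z == i then d else g z.

Lemma upd_eq (T : Type) (g : nat -> T) i d : upd g i d i = d.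
Proof. by rewrite /upd eqxx. Qed.

Lemma upd_neq (T : Type) (g : nat -> T) i j d : j != i -> upd g i d j = g j.
Proof. by rewrite /upd => /negbTE->. Qed.

Inductive op := Nop | Inc of nat | Dec of nat | Zero of nat.

(** Regular programs: the number of iterations of a [Star] is guessed, and a [Zero] test placed
    after the loop discards the runs that leave it too early. *)
Inductive cmd := Op of op | Seq of cmd & cmd | Star of cmd.

Lemma op_comparable : comparable op.
Proof.
move=> o o'; rewrite /decidable; decide equality; exact: eq_comparable.
Qed.

HB.instance Definition _ := hasDecEq.Build op (compareP op_comparable).

Lemma cmd_comparable : comparable cmd.
Proof.
move=> c c'; rewrite /decidable; decide equality; exact: op_comparable.
Qed.

HB.instance Definition _ := hasDecEq.Build cmd (compareP cmd_comparable).

Notation store := (nat -> nat).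

Definition op_sem (o : op) (s s' : store) : Prop :=
  match o with
  | Nop => s' = s
  | Inc j => s' = upd s j (s j).+1
  | Dec j => 0 < s j /\ s' = upd s j (s j).-1
  | Zero j => s j = 0 /\ s' = s
  end.

Inductive star (T : Type) (r : T -> T -> Prop) (s : T) : T -> Prop :=
  | star_refl : star r s s
  | star_step t u : r s t -> star r t u -> star r s u.

Lemma star_snoc (T : Type) (r : T -> T -> Prop) s t u :
  star r s t -> r t u -> star r s u.
Proof.
elim=> [{}s|{}s s1 {}t rs _ IH] rtu; last by apply: star_step rs (IH rtu).
by apply: star_step rtu (star_refl _ _).
Qed.

Lemma star_inv (T : Type) (r : T -> T -> Prop) (inv : T -> Prop) s t :
  (forall s t, inv s -> r s t -> inv t) -> star r s t -> inv s -> inv t.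
Proof. by move=> rI; elim=> // {}s u {}t su _ IH /rI/(_ su). Qed.

(** For loops, [star_inv] serves the half of [implements] about all runs, and this lemma the half
    about existence: the measure [m] reaches 0, where the exit test succeeds. *)
Lemma star_terminates (T : Type) (r : T -> T -> Prop) (inv : T -> Prop)
    (m : T -> nat) s :
  (forall s, inv s -> 0 < m s -> exists t, [/\ r s t, inv t & m t < m s]) ->
  inv s -> exists t, [/\ star r s t, inv t & m t = 0].
Proof.
move=> rI; have [n] := ubnP (m s); elim: n s => // n IHn s le_s inv_s.
have [ms0|/(rI _ inv_s)[t [st inv_t lt_t]]] := posnP (m s).
  by exists s; split=> //; exact: star_refl.
have [|u [tu inv_u mu]] := IHn t _ inv_t; first by lia.
by exists u; split=> //; apply: star_step tu.
Qed.

Fixpoint cmd_sem (c : cmd) : store -> store -> Prop :=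
  match c with
  | Op o => op_sem o
  | Seq c1 c2 => fun s s' => exists2 t, cmd_sem c1 s t & cmd_sem c2 t s'
  | Star c => star (cmd_sem c)
  end.

Definition seqs (c : cmd) (cs : seq cmd) : cmd := foldl Seq c cs.

(* Registers from [b] on are scratch: nothing is promised about their final
   contents, and nothing is assumed about their initial contents. *)
Definition implements (c : cmd) (b o : nat) (rel : store -> nat -> Prop) :=
  (forall s s', cmd_sem c s s' ->
     rel s (s' o) /\ forall i, i < b -> i != o -> s' i = s i) /\
  (forall s y, rel s y -> exists2 s', cmd_sem c s s' & s' o = y).

Definition clear (o : nat) : cmd := Seq (Star (Op (Dec o))) (Op (Zero o)).

Lemma clear_sem o s s' : cmd_sem (clear o) s s' <-> s' = upd s o 0.
Proof.
split.
  case=> /= t st [to ->].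
  have inv i : i != o -> t i = s i.
    apply: (star_inv (inv := fun t => i != o -> t i = s i)) st _ => // u v IH.
    by case=> _ -> io; rewrite upd_neq ?IH.
  apply: functional_extensionality => i; rewrite /upd.
  by case: eqP => [->//|/eqP/inv].
move=> ->; exists (upd s o 0) => /=; last by rewrite upd_eq.
have [||t [st ts t0]] := @star_terminates _ (op_sem (Dec o))
    (fun t => forall i, i != o -> t i = s i) (fun t => t o) s.
- move=> t ts t0; exists (upd t o (t o).-1); split=> //=.
    by move=> i io; rewrite upd_neq ?ts.
  by rewrite upd_eq; lia.
- by [].
suff <-: t = upd s o 0 by [].
by apply: functional_extensionality => i; rewrite /upd; case: eqP => [->//|/eqP/ts].
Qed.

(** A counter can be read only by emptying it, so [a] is poured into [o] and the scratch register
    [t] at once, and is then restored from [t]. *)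
Definition copy (a o t : nat) : cmd :=
  seqs (clear o)
    [:: clear t; Star (seqs (Op (Dec a)) [:: Op (Inc o); Op (Inc t)]);
        Op (Zero a); Star (Seq (Op (Dec t)) (Op (Inc a))); Op (Zero t)].

Lemma copy_implements a o b :
  a < b -> o < b -> a != o -> implements (copy a o b) b o (fun s y => y = s a).
Proof.
move=> ab ob ao.
have [oa ba bo] : [/\ o != a, b != a & b != o] by split; lia.
(* [inv1] is the invariant of the loop that empties [a], and [inv2] that of the loop that refills it
   from the scratch register [b]. *)
pose inv1 s (t : store) := [/\ t o + t a = s a, t b = t o
  & forall i, i < b -> i != o -> i != a -> t i = s i].
pose inv2 s (t : store) := [/\ t a + t b = s a, t o = s a
  & forall i, i < b -> i != o -> i != a -> t i = s i].
have init s : inv1 s (upd (upd s o 0) b 0).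
  split=> [||i ib io ia]; rewrite /upd ?eqxx.
  - by rewrite (negbTE ao) eq_sym (negbTE bo) eq_sym (negbTE ba).
  - by case: ifP.
  by rewrite (ltn_eqF ib) (negbTE io).
have pres1 s t : inv1 s t -> 0 < t a ->
    inv1 s (upd (upd (upd t a (t a).-1) o (t o).+1) b (t b).+1).
  case=> t1 t2 t3 ta; split=> [||i ib io ia]; rewrite /upd ?eqxx.
  - rewrite [o == b]eq_sym (negbTE bo) [a == b]eq_sym (negbTE ba) (negbTE ao).
    by lia.
  - by rewrite [o == b]eq_sym (negbTE bo) t2.
  by rewrite (ltn_eqF ib) (negbTE io) (negbTE ia) t3.
have pres2 s t : inv2 s t -> 0 < t b ->
    inv2 s (upd (upd t b (t b).-1) a (t a).+1).
  case=> t1 t2 t3 ta; split=> [||i ib io ia]; rewrite /upd ?eqxx.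
  - by rewrite (negbTE ba); lia.
  - by rewrite (negbTE oa) [o == b]eq_sym (negbTE bo) t2.
  by rewrite (negbTE ia) (ltn_eqF ib) t3.
set body1 := seqs (Op (Dec a)) [:: Op (Inc o); Op (Inc b)].
set body2 := Seq (Op (Dec b)) (Op (Inc a)).
split.
  move=> s s'.
  case=> t5 [t4 [t3 [t2 [t1 /clear_sem-> /clear_sem->]]]] st2 [t3a ->{t4}] st4.
  case=> t5b ->{s'}.
  have step1 t t' : inv1 s t -> cmd_sem body1 t t' -> inv1 s t'.
    move=> ti [u [v [v0 ->] ->] ->]; have := pres1 _ _ ti v0.
    by rewrite /upd /= !(negbTE oa, negbTE ba, negbTE bo).
  have step2 t t' : inv2 s t -> cmd_sem body2 t t' -> inv2 s t'.
    move=> ti [u [u0 ->] ->].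
    by have := pres2 _ _ ti u0; rewrite /upd /= eq_sym (negbTE ba).
  have [i1 i2 i3] := star_inv step1 st2 (init s).
  have [|j1 j2 j3] := star_inv step2 st4; first by split=> //; lia.
  split=> // i ib io; have [->|ia] := eqVneq i a; first by lia.
  exact: j3.
move=> s _ ->.
have [|t [st1 [t1 t2 t3] ta]] :=
  @star_terminates _ (cmd_sem body1) (inv1 s) (fun t => t a) _ _ (init s).
  move=> t ti t0; exists (upd (upd (upd t a (t a).-1) o (t o).+1) b (t b).+1).
  split; last 1 first.
  - by rewrite /upd !eqxx [a == b]eq_sym (negbTE ba) (negbTE ao); lia.
  - exists (upd (upd t a (t a).-1) o (t o).+1) => /=.
      exists (upd t a (t a).-1) => //=.
      by rewrite (@upd_neq _ t a o).
    by rewrite [upd _ _ _ b]upd_neq // [upd _ _ _ b]upd_neq.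
  exact: pres1.
have [||u [st2 [u1 u2 u3] ub]] := @star_terminates _
    (cmd_sem body2) (inv2 s) (fun t => t b) t.
- move=> v vi v0; exists (upd (upd v b (v b).-1) a (v a).+1); split.
  + by exists (upd v b (v b).-1) => //=; rewrite [upd _ _ _ a]upd_neq // eq_sym.
  + exact: pres2.
  by rewrite /upd (negbTE ba) eqxx; lia.
- by split=> //; lia.
exists u; last by [].
exists u => //=; exists t => //; exists t => //; exists (upd (upd s o 0) b 0) => //.
by exists (upd s o 0); apply/clear_sem.
Qed.

(** * Compiling recursive functions *)

Lemma eq_in_map_tuple (T : eqType) (T' : Type) k (f g : T -> T') (a : k.-tuple T) :
  {in a, f =1 g} -> map_tuple f a = map_tuple g a.
Proof. by move=> fg; apply: val_inj; apply/eq_in_map. Qed.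

Lemma map_thead (T T' : Type) k (f : T -> T') (a : k.+1.-tuple T) :
  thead (map_tuple f a) = f (thead a).
Proof. by rewrite /thead tnth_map. Qed.

Lemma map_behead (T T' : Type) k (f : T -> T') (a : k.+1.-tuple T) :
  [tuple of behead (map_tuple f a)] = map_tuple f [tuple of behead a].
Proof. by apply: val_inj; rewrite /= behead_map. Qed.

(** The value of [h i] goes to register [b + i]. All members use scratch registers from [b + m] on,
    so computing one of them destroys neither the arguments nor the earlier values. *)
Lemma compile_family k m (h : 'I_m -> recfun k) (args : k.-tuple nat) b :
  (forall i o b, {in args, forall a, a < b} -> o < b -> o \notin args ->
     exists c, implements c b o (fun s => computes (h i) (map_tuple s args))) ->
  {in args, forall a, a < b} ->
  forall n, n <= m -> exists c,
    (forall s s', cmd_sem c s s' ->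
       (forall i : 'I_m, i < n -> computes (h i) (map_tuple s args) (s' (b + i)))
       /\ forall i, i < b -> s' i = s i) /\
    (forall s (w : m.-tuple nat),
       (forall i, computes (h i) (map_tuple s args) (tnth w i)) ->
       exists2 s', cmd_sem c s s' & forall i : 'I_m, i < n -> s' (b + i) = tnth w i).
Proof.
move=> IH args_b; elim=> [|n IHn] le_n.
  exists (Op Nop); split=> [s s' ->|s w _]; first by split.
  by exists s.
have [c [c1 c2]] := IHn (ltnW le_n).
have [||| c' [c'1 c'2]] := IH (Ordinal le_n) (b + n) (b + m).
- by move=> a /args_b; lia.
- by lia.
- by apply/negP => /args_b; lia.
have mapE (s s' : store) : (forall i, i < b -> s' i = s i) ->
    map_tuple s' args = map_tuple s args.
  by move=> ss; apply: eq_in_map_tuple => a /args_b /ss.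
exists (Seq c c'); split.
  move=> s s' [t /c1[t1 t2] /c'1[s1 s2]]; split=> [i|i ib]; last first.
    by rewrite s2 ?t2 //; lia.
  rewrite ltnS leq_eqVlt => /orP[/eqP in_|lt_in]; last first.
    by rewrite s2; [exact: t1|have := ltn_ord i; lia|lia].
  have -> : i = Ordinal le_n by apply: val_inj.
  by rewrite /= -(mapE s t).
move=> s w hw; have [t st tw] := c2 _ _ hw.
have [t1 t2] := c1 _ _ st.
have [|u tu ub] := c'2 t (tnth w (Ordinal le_n)); first by rewrite (mapE s t).
exists u; first by exists t.
have [u1 u2] := c'1 _ _ tu.
move=> i; rewrite ltnS leq_eqVlt => /orP[/eqP in_|lt_in].
  by rewrite in_ ub; congr (tnth w _); apply: val_inj.
by rewrite u2 ?tw //; have := ltn_ord i; lia.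
Qed.

(** The recursion becomes a loop. An output register may not be among the arguments, so the step
    function writes to [b + 2], and the result is then copied to the accumulator, which is one of
    its arguments. *)
Lemma compile_prim k (f : recfun k) (h : recfun k.+2) (args : k.+1.-tuple nat) o b :
  (forall (args : k.-tuple nat) o b, {in args, forall a, a < b} -> o < b ->
     o \notin args ->
     exists c, implements c b o (fun s => computes f (map_tuple s args))) ->
  (forall (args : k.+2.-tuple nat) o b, {in args, forall a, a < b} -> o < b ->
     o \notin args ->
     exists c, implements c b o (fun s => computes h (map_tuple s args))) ->
  {in args, forall a, a < b} -> o < b -> o \notin args ->
  exists c, implements c b o (fun s => computes (RPrim f h) (map_tuple s args)).
Proof.
move=> IHf IHh args_b ob o_args.
have rest_b : {in behead args, forall a, a < b}.
  by move=> a /mem_behead /args_b.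
have a0_b : thead args < b by apply/args_b/mem_tnth.
have [||| cf [f1 f2]] := IHf [tuple of behead args] b (b + 4).
- by move=> a /rest_b; lia.
- by lia.
- by apply/negP => /rest_b; lia.
have [||| ch [h1 h2]] :=
  IHh [tuple of b.+1 :: b :: behead args] (b + 2) (b + 4).
- by move=> a /[!inE] /or3P[/eqP->|/eqP->|/rest_b]; lia.
- by lia.
- by rewrite !inE; apply/negP => /or3P[/eqP|/eqP|/rest_b]; lia.
have [||| i1 i2] := @copy_implements (thead args) (b + 3) (b + 4); try lia.
have [||| j1 j2] := @copy_implements (b + 2) b (b + 4); try lia.
have [||| k1 k2] := @copy_implements b o (b + 4); try lia.
set ci := copy _ _ _ in i1 i2; set cj := copy _ _ _ in j1 j2.
set ck := copy _ _ _ in k1 k2.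
pose body := seqs (Op (Dec (b + 3))) [:: ch; cj; Op (Inc b.+1)].
exists (seqs ci [:: clear b.+1; cf; Star body; Op (Zero (b + 3)); ck]).
pose v (s : store) := map_tuple s [tuple of behead args].
have vE (s s' : store) : (forall i, i < b -> s' i = s i) -> v s' = v s.
  by move=> ss; apply: eq_in_map_tuple => a /rest_b /ss.
have hE (s : store) : map_tuple s [tuple of b.+1 :: b :: behead args] =
    [tuple of s b.+1 :: s b :: v s].
  exact: val_inj.
have vB (s : store) i a :
    [tuple of i :: a :: behead (map_tuple s args)] = [tuple of i :: a :: v s].
  by apply: val_inj; rewrite /= behead_map.
have vE2 (s s' : store) i a : (forall i, i < b -> s' i = s i) ->
    [tuple of i :: a :: v s'] = [tuple of i :: a :: v s].
  by move=> /vE/(congr1 val) /= ss; apply: val_inj; rewrite /= ss.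
(* [b] holds the accumulator, [b + 1] counts up and [b + 3] counts down. *)
have bodyP s t : cmd_sem body s t ->
    [/\ s (b + 3) = (t (b + 3)).+1, t b.+1 = (s b.+1).+1,
        computes h [tuple of s b.+1 :: s b :: v s] (t b)
      & forall i, i < b -> t i = s i].
  case=> t4 [t3 [t2 [s3 e2] /h1[e3 e3']] /j1[e4 e4']] et.
  have tE i : t i = if i == b.+1 then (t4 b.+1).+1 else t4 i by rewrite et.
  have t2E i : t2 i = if i == b + 3 then (s (b + 3)).-1 else s i by rewrite e2.
  rewrite hE !t2E !ltn_eqF /v in e3; try lia.
  rewrite (_ : map_tuple t2 _ = v s) in e3; last first.
    by apply: vE => i ib; rewrite t2E ltn_eqF //; lia.
  have t4E i : i < b + 4 -> i != b -> i != b + 2 -> t4 i = t2 i.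
    by move=> ib i1' i2'; rewrite e4' // e3' //; lia.
  split.
  - by rewrite tE gtn_eqF ?t4E ?t2E ?eqxx; lia.
  - have t2C : t2 b.+1 = s b.+1 by rewrite t2E ltn_eqF; lia.
    by rewrite tE eqxx t4E ?t2C; lia.
  - by rewrite tE (ltn_eqF (ltnSn b)) e4.
  move=> i ib; rewrite tE ltn_eqF ?t4E ?t2E; try lia.
  by rewrite ltn_eqF; lia.
have bodyT s y : 0 < s (b + 3) -> computes h [tuple of s b.+1 :: s b :: v s] y ->
    exists2 t, cmd_sem body s t & t b = y.
  move=> s3 hy; pose t2 := upd s (b + 3) (s (b + 3)).-1.
  have t2E i : t2 i = if i == b + 3 then (s (b + 3)).-1 else s i by [].
  have [|t3 t23 t3y] := h2 t2 y.
    rewrite hE !t2E !ltn_eqF; try lia.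
    by rewrite (vE2 s) // => i ib; rewrite t2E ltn_eqF //; lia.
  have [t4 t34 t4y] := j2 t3 _ erefl.
  exists (upd t4 b.+1 (t4 b.+1).+1); last first.
    by rewrite upd_neq ?t4y //; lia.
  by exists t4 => //; exists t3 => //; exists t2.
have initP s t u : cmd_sem ci s t -> cmd_sem cf (upd t b.+1 0) u ->
    [/\ u (b + 3) = s (thead args), u b.+1 = 0, computes f (v s) (u b)
      & forall i, i < b -> u i = s i].
  move=> /i1[e1 e1'] /f1[e2 e2'].
  rewrite (_ : map_tuple _ _ = v s) in e2; last first.
    by apply: vE => i ib; rewrite upd_neq ?e1' //; lia.
  split=> [|||i ib]; [by rewrite e2' ?upd_neq; lia| |by []|].
    by rewrite e2' ?upd_eq; lia.
  by rewrite e2' ?upd_neq ?e1' //; lia.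
have initT s y : computes f (v s) y ->
    exists2 u, cmd_sem (seqs ci [:: clear b.+1; cf]) s u & u b = y.
  move=> fy; have [t st ti] := i2 s _ erefl.
  have [_ st'] := i1 _ _ st.
  have [|u tu uy] := f2 (upd t b.+1 0) y.
    by rewrite (_ : map_tuple _ _ = v s) //; apply: vE => i ib;
      rewrite upd_neq ?st' //; lia.
  exists u => //; exists (upd t b.+1 0) => //; exists t => //.
  exact/clear_sem.
split.
  move=> s s' [t5 [t4 [t3 [t2 [t1 e1]]]]] /clear_sem-> e2 e3 [z3 ->] /k1[e5 e5'].
  have [p1 p2 p3 p4] := initP _ _ _ e1 e2.
  pose inv (t : store) := [/\ t b.+1 + t (b + 3) = s (thead args),
    forall i, i < b -> t i = s i & exists S : nat -> nat,
    [/\ computes f (v s) (S 0), S (t b.+1) = t b & forall i, i < t b.+1 ->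
      computes h [tuple of i :: S i :: v s] (S i.+1)]].
  have step t t' : inv t -> cmd_sem body t t' -> inv t'.
    move=> [q1 q2 [S [S0 Sb SS]]] /bodyP[r1 r2 r3 r4].
    split; [lia|by move=> i ib; rewrite r4 ?q2|].
    (* The course of values computed so far is extended by the new content of the accumulator. *)
    exists (fun i => if i <= t b.+1 then S i else t' b); split=> //=.
      by rewrite r2 ltnn.
    move=> i; rewrite r2 ltnS => le_i; rewrite le_i.
    move: le_i; rewrite leq_eqVlt => /orP[/eqP->|lt_i].
      by rewrite ltnn Sb -(vE2 s t).
    by rewrite lt_i; apply: SS.
  have [|q1 q2 [S [S0 Sb SS]]] := star_inv step e3.
    by split; [rewrite p2 p1|exact: p4|exists (fun=> t3 b); split; rewrite ?p2].
  rewrite z3 addn0 in q1; split; last by move=> i ib io; rewrite e5' ?q2; lia.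
  exists S; rewrite map_behead map_thead -q1; split=> // [i /SS|].
    by rewrite vB.
  by rewrite e5 -Sb.
move=> s y [S []]; rewrite map_behead map_thead -/(v s) => S0 SS ->.
have [u su u0] := initT _ _ S0.
have [q1 q2 q3 q4] : [/\ u (b + 3) = s (thead args), u b.+1 = 0,
    computes f (v s) (u b) & forall i, i < b -> u i = s i].
  by case: su => t [t' st' /clear_sem->]; apply: initP.
have [||t [ut [t1 t2 t3] t0]] := @star_terminates _ (cmd_sem body)
  (fun t => [/\ t b.+1 + t (b + 3) = s (thead args), t b = S (t b.+1)
     & forall i, i < b -> t i = s i]) (fun t => t (b + 3)) u.
- move=> t [t1 t2 t3] t0; have [|t' tt' t'b] := bodyT t (S (t b.+1).+1) t0.
    by rewrite t2 (vE2 s) // -vB; apply: SS; lia.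
  have [r1 r2 r3 r4] := bodyP _ _ tt'.
  exists t'; split; [exact: tt'|split|lia]; first lia.
    by rewrite t'b r2.
  by move=> i ib; rewrite r4 ?t3.
- by rewrite q1 q2 u0.
have [s' ts' s'o] := k2 t _ erefl.
exists s'; last by rewrite s'o t2; congr S; lia.
by exists t => //; exists t => //; exists u.
Qed.

(** Register [b] runs through the candidates and [b + 1] receives the values of [f]. The [Dec]
    inside the loop passes only on a nonzero value and the [Zero] after it only on a zero one, so
    the guessed exit has to be at the first zero. *)
Lemma compile_min k (f : recfun k.+1) (args : k.-tuple nat) o b :
  (forall (args : k.+1.-tuple nat) o b, {in args, forall a, a < b} -> o < b ->
     o \notin args ->
     exists c, implements c b o (fun s => computes f (map_tuple s args))) ->
  {in args, forall a, a < b} -> o < b -> o \notin args ->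
  exists c, implements c b o (fun s => computes (RMin f) (map_tuple s args)).
Proof.
move=> IHf args_b ob o_args.
have [||| cf [f1 f2]] := IHf [tuple of b :: args] b.+1 b.+2.
- by move=> a /[!inE] /orP[/eqP->|/args_b]; lia.
- by lia.
- by rewrite !inE; apply/negP => /orP[/eqP|/args_b]; lia.
have [||| k1 k2] := @copy_implements b o b.+2; try lia.
set ck := copy _ _ _ in k1 k2.
pose body := seqs cf [:: Op (Dec b.+1); Op (Inc b)].
exists (seqs (clear b) [:: Star body; cf; Op (Zero b.+1); ck]).
pose v (s : store) := map_tuple s args.
have vE (s s' : store) : (forall i, i < b -> s' i = s i) -> v s' = v s.
  by move=> ss; apply: eq_in_map_tuple => a /args_b /ss.
have fE (s : store) : map_tuple s [tuple of b :: args] = [tuple of s b :: v s].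
  exact: val_inj.
have vE1 (s s' : store) i : (forall i, i < b -> s' i = s i) ->
    [tuple of i :: v s'] = [tuple of i :: v s].
  by move=> /vE/(congr1 val) /= ss; apply: val_inj; rewrite /= ss.
have bodyP s t : cmd_sem body s t ->
    [/\ t b = (s b).+1, exists z, computes f [tuple of s b :: v s] z.+1
      & forall i, i < b -> t i = s i].
  case=> t2 [t1 /f1[e1 e1']] [z1 ->] ->.
  split; [by rewrite upd_eq upd_neq ?e1' //; lia| |].
    by exists (t1 b.+1).-1; rewrite prednK // -fE.
  by move=> i ib; rewrite !upd_neq ?e1' //; lia.
split.
  move=> s s' [t5 [t4 [t3 [t2 /clear_sem->]]]] e1 /f1[e2 e2'] [z3 ->].
  move=> /k1[e3 e3'].
  pose inv (t : store) := (forall i, i < b -> t i = s i) /\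
    forall i, i < t b -> exists z, computes f [tuple of i :: v s] z.+1.
  have step t t' : inv t -> cmd_sem body t t' -> inv t'.
    move=> [q1 q2] /bodyP[r1 r2 r3]; split=> [i ib|i]; first by rewrite r3 ?q1.
    rewrite r1 ltnS leq_eqVlt => /orP[/eqP->|/q2//].
    by rewrite -(vE1 s t).
  have [|q1 q2] := star_inv step e1.
    by split=> i; rewrite ?upd_eq // => ib; rewrite upd_neq //; lia.
  rewrite z3 fE (vE1 s) // in e2.
  have e4 : t4 b = t3 b by rewrite e2' //; lia.
  split; last by move=> i ib io; rewrite e3' ?e2' ?q1 //; lia.
  by rewrite /= e3 e4.
move=> s y [f0 fpos].
have [t [st t1 t2]] : exists t, [/\ star (cmd_sem body) (upd s b 0) t,
    t b = y & forall i, i < b -> t i = s i].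
  elim: y fpos {f0} => [|n IHn] fpos.
    exists (upd s b 0); split; [exact: star_refl|by rewrite upd_eq|].
    by move=> i ib; rewrite upd_neq //; lia.
  have [|t [st t1 t2]] := IHn; first by move=> i ni; apply: fpos; lia.
  have [z fz] := fpos n (leqnn _).
  have [|u tu uz] := f2 t z.+1; first by rewrite fE t1 (vE1 s).
  pose u1 := upd u b.+1 (u b.+1).-1.
  have body_t : cmd_sem body t (upd u1 b (u1 b).+1).
    exists u1; last by [].
    by exists u => //; split; first by rewrite uz.
  exists (upd u1 b (u1 b).+1); split; first exact: star_snoc st body_t.
    by have [-> _ _] := bodyP _ _ body_t; rewrite t1.
  by move=> i ib; have [_ _ ->] := bodyP _ _ body_t; rewrite ?t2.
have [|u tu u0] := f2 t 0; first by rewrite fE t1 (vE1 s).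
have [s' us' s'o] := k2 u _ erefl.
exists s'; last first.
  by have [_ u1] := f1 _ _ tu; rewrite s'o u1 //; lia.
exists u => //; exists u => //; exists t => //; exists (upd s b 0) => //.
exact/clear_sem.
Qed.

Lemma compile k (r : recfun k) (args : k.-tuple nat) o b :
  {in args, forall a, a < b} -> o < b -> o \notin args ->
  exists c, implements c b o (fun s => computes r (map_tuple s args)).
Proof.
elim: r args o b => {k} [k||k i|k m f IHf h IHh|k f IHf h IHh|k f IHf]
  args o b args_b ob o_args.
- exists (clear o); split=> [s s' ss'|s y /= ->].
    have -> : s' = upd s o 0 by apply/clear_sem.
    by rewrite /= upd_eq; split=> // i _ io; rewrite upd_neq.
  by exists (upd s o 0); [apply/clear_sem|rewrite upd_eq].
- have a_b : thead args < b by apply/args_b/mem_tnth.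
  have ao : thead args != o by apply: contraNneq o_args => <-; apply: mem_tnth.
  have [c1 c2] := copy_implements a_b ob ao.
  exists (Seq (copy (thead args) o b) (Op (Inc o))); split.
    move=> s s' [t /c1[t1 t2] ->]; rewrite /= map_thead upd_eq t1; split=> //.
    by move=> i ib io; rewrite upd_neq ?t2.
  move=> s y; rewrite /= map_thead => ->; have [t st to] := c2 s _ erefl.
  by exists (upd t o (t o).+1); [exists t|rewrite upd_eq to].
- have a_b : tnth args i < b by apply/args_b/mem_tnth.
  have ao : tnth args i != o by apply: contraNneq o_args => <-; apply: mem_tnth.
  have [c1 c2] := copy_implements a_b ob ao.
  exists (copy (tnth args i) o b); split=> s y; rewrite /= tnth_map.
    by move=> /c1[].
  exact: c2.
- have [|c [c1 c2]] := compile_family (h := h) _ args_b (leqnn m).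
    by move=> i; apply: IHh.
  have bmem a : a \in [tuple b + i | i < m] -> b <= a < b + m.
    by case/mapP=> i _ ->; have := ltn_ord i; lia.
  have [|||c' [c'1 c'2]] := IHf [tuple b + i | i < m] o (b + m).
  + by move=> a /bmem; lia.
  + by lia.
  + by apply/negP => /bmem; lia.
  exists (Seq c c'); split.
    move=> s s' [t /c1[t1 t2] /c'1[e1 e2]]; split; last first.
      by move=> i ib io; rewrite e2 ?t2 //; lia.
    exists (map_tuple t [tuple b + i | i < m]); split=> // i.
    by rewrite tnth_map tnth_mktuple; apply: t1.
  move=> s y [w [hw fw]]; have [t st tw] := c2 _ _ hw.
  have [|s' ts' s'o] := c'2 t y; last by exists s' => //; exists t.
  rewrite (_ : map_tuple _ _ = w) //; apply: eq_from_tnth => i.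
  by rewrite tnth_map tnth_mktuple tw.
- exact: compile_prim.
- exact: compile_min.
Qed.

Lemma computes_inj k (r : recfun k) v y y' :
  computes r v y -> computes r v y' -> y = y'.
Proof.
elim: r v y y' => {k} [k||k i|k m f IHf h IHh|k f IHf h IHh|k f IHf] v y y' /=.
- by move=> -> ->.
- by move=> -> ->.
- by move=> -> ->.
- case=> w [hw fw] [w' [hw' fw']]; apply: IHf fw _.
  suff -> : w = w' by [].
  by apply: eq_from_tnth => i; apply: IHh (hw i) (hw' i).
- case=> s [s0 ss ->] [s' [s'0 ss' ->]].
  move: {-2}(thead v) (leqnn (thead v)).
  elim=> [_|n IHn lt_n]; first exact: IHf s0 s'0.
  have hs := ss _ lt_n; rewrite (IHn (ltnW lt_n)) in hs.
  exact: IHh hs (ss' _ lt_n).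
case=> f0 fpos [f0' fpos']; case: (ltngtP y y') => // lt_y.
  by have [z /IHf/(_ f0)] := fpos' _ lt_y.
by have [z /IHf/(_ f0')] := fpos _ lt_y.
Qed.

Definition input (n : nat) : store := upd (fun=> 0) 0 n.

(** The witness is guessed by a loop in register 1, [Q] is computed into register 2, and a final
    [Dec] or [Zero] blocks the runs with the wrong truth value. Having both values of [v] serves the
    two halves of the theorem. *)
Lemma search_program (Q : nat -> nat -> bool) (v : bool) : recursive_rel Q ->
  exists c, forall n,
    (exists s, cmd_sem c (input n) s) <-> exists m, Q n m = v.
Proof.
case=> r rQ; have [|||c [c1 c2]] := @compile _ r [tuple 0; 1] 2 3; try by [].
  by move=> a; rewrite !inE => /orP[] /eqP->.
exists (seqs (Star (Op (Inc 1))) [:: c; Op (if v then Dec 2 else Zero 2)]) => n.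
have inE_ (s : store) : map_tuple s [tuple 0; 1] = [tuple s 0; s 1].
  exact: val_inj.
split.
  case=> s [t [u nu /c1[cu _]] vt]; exists (u 1).
  have u0 : u 0 = n.
    by apply: (star_inv (inv := fun u => u 0 = n) _ nu) => // s1 s2 <- ->.
  rewrite inE_ u0 in cu; have := computes_inj cu (rQ n (u 1)).
  by case: v vt => -[]; case: (Q n _) => //; lia.
case=> m Qv; have nm : star (op_sem (Inc 1)) (input n) (upd (input n) 1 m).
  elim: m {Qv} => [|m IHm].
    rewrite (_ : upd _ _ _ = input n); first exact: star_refl.
    by apply: functional_extensionality => -[|[|i]].
  apply: star_snoc IHm _.
  by apply: functional_extensionality => -[|[|i]].
have [|t ut t2] := c2 (upd (input n) 1 m) (Q n m); first by rewrite inE_; apply: rQ.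
exists (if v then upd t 2 (t 2).-1 else t).
exists t; first by exists (upd (input n) 1 m).
by case: (v) Qv => /= Qv; rewrite t2 Qv.
Qed.

(** * Recursive operations on formulas *)

Lemma recursive_comp f g :
  recursive_fun f -> recursive_fun g -> recursive_fun (fun n => f (g n)).
Proof.
case=> r rf [t tg]; exists (RComp r (fun=> t)) => n.
by exists [tuple g n]; split=> // i; rewrite ord1.
Qed.

Lemma recursive_comp2 (t : recfun 2) (h : nat -> nat -> nat) f g :
  (forall a b, computes t [tuple a; b] (h a b)) ->
  recursive_fun f -> recursive_fun g -> recursive_fun (fun n => h (f n) (g n)).
Proof.
move=> th [r rf] [s sg]; exists (RComp t (fun i => if val i == 0 then r else s)).
by move=> n; exists [tuple f n; g n]; split=> // -[[|[|i]] lt_i] //.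
Qed.

Lemma recursive_id : recursive_fun id.
Proof. by exists (RProj ord0). Qed.

Lemma recursive_succ : recursive_fun succn.
Proof. by exists RSucc. Qed.

Lemma constant_fun_computable m : exists r : recfun 0, computes r [tuple] m.
Proof.
elim: m => [|m [r rm]]; first by exists (RZero 0).
by exists (RComp RSucc (fun=> r)), [tuple m]; split=> // i; rewrite ord1.
Qed.

Lemma recursive_const m : recursive_fun (fun=> m).
Proof.
have [r rm] := constant_fun_computable m.
exists (RComp r (fun i : 'I_0 => RZero 1)) => n.
by exists [tuple]; split=> // -[].
Qed.

Lemma recursive_iter f m :
  recursive_fun f -> recursive_fun (fun n => iter n f m).
Proof.
case=> r rf; have [t tm] := constant_fun_computable m.
exists (RPrim t (RComp r (fun=> RProj (@Ordinal 2 1 isT)))) => n.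
exists (fun i => iter i f m); split=> //.
  by rewrite (_ : [tuple of _] = [tuple]) //; apply: tuple0.
move=> i _; exists [tuple iter i f m]; split=> [j|]; last exact: rf.
by rewrite ord1.
Qed.

(** [CodeSeq.code] is the right fold of this function, starting from 0. *)
Definition code_cons (a b : nat) : nat := 2 ^ a * b.*2.+1.

Lemma recursive_double : recursive_fun double.
Proof.
have [r rP] : recursive_fun (fun n => iter n (fun m => m.+2) 0).
  apply: recursive_iter.
  exact: recursive_comp recursive_succ recursive_succ.
exists r => n; rewrite (_ : n.*2 = iter n (fun m => m.+2) 0) //.
Qed.

Lemma recursive_code_cons f g : recursive_fun f -> recursive_fun g ->
  recursive_fun (fun n => code_cons (f n) (g n)).
Proof.
have [s sP] := recursive_comp recursive_succ recursive_double.
have [d dP] := recursive_double.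
(* Recursion on [a]: start with twice [b] plus one and double [a] times. *)
pose t := RPrim s (RComp d (fun=> RProj (@Ordinal 3 1 isT))).
apply: (recursive_comp2 (t := t)) => a b.
exists (fun i => code_cons i b); split=> //.
  rewrite (_ : [tuple of _] = [tuple b]); last exact: val_inj.
  by rewrite /code_cons mul1n; apply: sP.
move=> i _; exists [tuple code_cons i b]; split=> [j|].
  by rewrite ord1.
rewrite (_ : code_cons i.+1 b = (code_cons i b).*2); first exact: dP.
by rewrite /code_cons expnS; lia.
Qed.

Lemma recursive_code (s : seq (nat -> nat)) : foldr and True (map recursive_fun s) ->
  recursive_fun (fun n => CodeSeq.code [seq f n | f <- s]).
Proof.
elim: s => [_|f s IHs [rf /IHs rs]]; first exact: recursive_const.
exact: recursive_code_cons rf rs.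
Qed.

Definition recursive_op (F : form -> form) : Prop :=
  exists2 G, recursive_fun G & forall A, godel (F A) = G (godel A).

Lemma recursive_op_id : recursive_op id.
Proof. by exists id => //; apply: recursive_id. Qed.

Lemma recursive_op_const B : recursive_op (fun=> B).
Proof. by exists (fun=> godel B) => //; apply: recursive_const. Qed.

Lemma recursive_op_Imp F1 F2 : recursive_op F1 -> recursive_op F2 ->
  recursive_op (fun A => Imp (F1 A) (F2 A)).
Proof.
case=> [G1 r1 e1] [G2 r2 e2].
exists (fun n => CodeSeq.code [:: 2; G1 n; G2 n]) => [|A]; last by rewrite /= e1 e2.
by apply: (@recursive_code [:: fun=> 2; G1; G2]); split=> //; apply: recursive_const.
Qed.

Lemma recursive_op_Box F : recursive_op F -> recursive_op (fun A => Box (F A)).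
Proof.
case=> [G r e]; exists (fun n => CodeSeq.code [:: 3; G n]) => [|A].
  by apply: (@recursive_code [:: fun=> 3; G]); split=> //; apply: recursive_const.
by rewrite /= e.
Qed.

Lemma recursive_op_All z F : recursive_op F -> recursive_op (fun A => All z (F A)).
Proof.
case=> [G r e]; exists (fun n => CodeSeq.code [:: 4; z; G n]) => [|A].
  by apply: (@recursive_code [:: fun=> 4; fun=> z; G]);
    do ?split=> //; apply: recursive_const.
by rewrite /= e.
Qed.

(** Both reductions have this shape: the input only determines how often one fixed operation is
    iterated. Its action on codes is composed from [CodeSeq.code], so no formula has to be
    decoded. *)
Lemma recursive_op_iter F1 F2 B : recursive_op F1 -> recursive_op F2 ->
  recursive_fun (fun n => godel (F1 (iter n F2 B))).
Proof.
case=> [G1 r1 e1] [G2 r2 e2].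
have [r rP] := recursive_comp r1 (recursive_iter (godel B) r2).
exists r => n; rewrite e1 (_ : godel _ = iter n G2 (godel B)); first exact: rP.
by elim: n => //= n <-.
Qed.

(** * The formula of a program *)

(** A control state is a continuation, that is, the list of commands still to be executed. Collected
    here are those that arise before [c] is finished, when [k] remains after it; there are finitely
    many. *)
Fixpoint conts (c : cmd) (k : seq cmd) : seq (seq cmd) :=
  (c :: k) :: match c with
              | Op _ => [::]
              | Seq c1 c2 => conts c1 (c2 :: k) ++ conts c2 k
              | Star c1 => conts c1 (c :: k)
              end.

Definition states (c : cmd) : seq (seq cmd) := [::] :: conts c [::].

Definition transitions (k : seq cmd) : seq (op * seq cmd) :=
  match k with
  | [::] => [::]
  | Op o :: k => [:: (o, k)]
  | Seq c1 c2 :: k => [:: (Nop, [:: c1, c2 & k])]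
  | Star c :: k => [:: (Nop, k); (Nop, [:: c, Star c & k])]
  end.

(** Odd tags belong to registers and even ones to control states, so the two kinds never clash. *)
Definition reg_tag (i : nat) : nat := i.*2.+1.
Definition state_tag (c : cmd) (k : seq cmd) : nat := (index k (states c)).*2.

Definition Top : form := Imp Bot Bot.
Definition And (A B : form) : form := Neg (Imp A (Neg B)).
Definition Dia (A : form) : form := Neg (Box (Neg A)).
Definition Ex (z : nat) (A : form) : form := Neg (All z (Neg A)).
Definition bigAnd : seq form -> form := foldr And Top.

Section Formulas.

Variables (x y P p : nat).

Definition marker : form := Atom p [tuple].
Definition patom (u : nat) : form := Atom P [tuple u].

(** In the intended model configurations avoid [P] at every marker, so that holding at a future
    marker singles out the special elements. *)
Definition special (u : nat) : form := Dia (And marker (patom u)).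

(* In the intended model, the special elements are indexed by the natural
   numbers and [rank j] defines those of index at least [j], at every world
   that has a marker of every kind in its future. *)
Fixpoint rank (j u v : nat) : form :=
  match j with
  | 0 => special u
  | j.+1 =>
      Dia (And marker (And (patom u) (Ex v (And (rank j v u) (Neg (patom v))))))
  end.

(** The special elements in [P] have maximal rank exactly [j]. At the markers of the intended model
    their ranks are unbounded, so a marker carries no tag. *)
Definition tag_form (j : nat) : form :=
  And (Ex x (And (rank j x y) (patom x)))
      (Neg (Ex x (And (rank j.+1 x y) (patom x)))).

Definition in_reg (i u : nat) : form := And (tag_form (reg_tag i)) (patom u).

(** As [R] may be reflexive at some worlds, nested diamonds alone could count one world repeatedly.
    The marker in between forces a move to a new world in the intended model. *)
Definition count_step (i u : nat) (A : form) : form :=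
  Dia (And marker (Dia (And (in_reg i u) A))).

(** The first conjunct exempts the special elements from the rules. *)
Definition in_state (q u : nat) : form :=
  And (Neg (special u)) (Dia (And (tag_form q) (patom u))).

Definition extra (i u v : nat) : form := And (in_reg i v) (Neg (patom u)).

Definition extra_later (i u v : nat) : form :=
  Dia (And marker (Dia (extra i u v))).

(* The extra worlds of [v] count as exactly one: they come later than those of
   [u] and are separated from them, but not from each other, by markers. *)
Definition incremented (i u v : nat) : form :=
  bigAnd [:: Box (Imp (in_reg i u) (patom v));
             extra_later i u v;
             Box (Imp (in_reg i u) (extra_later i u v));
             Box (Imp (extra i u v) (Box (Neg (in_reg i u))));
             Box (Imp (extra i u v) (Box (Imp marker (Box (Neg (extra i u v))))))].

Definition unchanged (i u v : nat) : form :=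
  Box (Imp (tag_form (reg_tag i))
    (And (Imp (patom u) (patom v)) (Imp (patom v) (patom u)))).

Definition guard (o : op) (u : nat) : form :=
  match o with
  | Dec j => count_step j u Top
  | Zero j => Neg (count_step j u Top)
  | _ => Top
  end.

Definition update (o : op) (u v i : nat) : form :=
  match o with
  | Inc j => if i == j then incremented i u v else unchanged i u v
  | Dec j => if i == j then incremented i v u else unchanged i u v
  | _ => unchanged i u v
  end.

Definition rule (c : cmd) (m : nat) (k : seq cmd) (t : op * seq cmd) : form :=
  All x (Imp (in_state (state_tag c k) x) (Imp (guard t.1 x)
    (Ex y (And (in_state (state_tag c t.2) y)
               (bigAnd [seq update t.1 x y i | i <- iota 0 m.+1]))))).

Definition rules (c : cmd) (m : nat) : form :=
  bigAnd [seq bigAnd [seq rule c m k t | t <- transitions k] | k <- states c].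

(** The input enters only through [A], which will say that register 0 is at least [n]; together with
    the negation of its [count_step] this fixes the value. Isolating [A] gives the shape required by
    [recursive_op_iter]. *)
Definition run_context (c : cmd) (m : nat) (A : form) : form :=
  And (And (rules c m) (All x (Neg (in_state (state_tag c [::]) x))))
    (Ex x (And (And (in_state (state_tag c [:: c]) x)
                    (bigAnd [seq Neg (count_step i x Top) | i <- iota 1 m]))
               (And A (Neg (count_step 0 x A))))).

(* Satisfiable iff [c], with registers [0], ..., [m], has no terminating run
   on input [n]. *)
Definition run (c : cmd) (m n : nat) : form :=
  run_context c m (iter n (count_step 0 x) Top).

(** * Recursiveness of the map from inputs to formulas *)

Lemma recursive_op_And F1 F2 : recursive_op F1 -> recursive_op F2 ->
  recursive_op (fun A => And (F1 A) (F2 A)).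
Proof.
move=> r1 r2; apply: recursive_op_Imp (recursive_op_const _).
by apply: recursive_op_Imp r1 _; apply: recursive_op_Imp r2 (recursive_op_const _).
Qed.

Lemma recursive_op_Neg F : recursive_op F -> recursive_op (fun A => Neg (F A)).
Proof. by move=> r; apply: recursive_op_Imp r (recursive_op_const _). Qed.

Lemma recursive_op_Dia F : recursive_op F -> recursive_op (fun A => Dia (F A)).
Proof.
by move=> r; apply/recursive_op_Neg/recursive_op_Box/recursive_op_Neg.
Qed.

Lemma recursive_op_Ex z F : recursive_op F -> recursive_op (fun A => Ex z (F A)).
Proof.
by move=> r; apply/recursive_op_Neg/recursive_op_All/recursive_op_Neg.
Qed.

Lemma recursive_op_count_step i u : recursive_op (count_step i u).
Proof.
apply/recursive_op_Dia/recursive_op_And; first exact: recursive_op_const.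
apply/recursive_op_Dia/recursive_op_And; first exact: recursive_op_const.
exact: recursive_op_id.
Qed.

Lemma recursive_op_run_context c m : recursive_op (run_context c m).
Proof.
apply: recursive_op_And; first exact: recursive_op_const.
apply/recursive_op_Ex/recursive_op_And; first exact: recursive_op_const.
apply: recursive_op_And; first exact: recursive_op_id.
exact/recursive_op_Neg/recursive_op_count_step.
Qed.

Lemma recursive_run c m : recursive_fun (fun n => godel (run c m n)).
Proof.
exact: recursive_op_iter (recursive_op_run_context c m) (recursive_op_count_step _ _).
Qed.

Lemma recursive_Neg_run c m : recursive_fun (fun n => godel (Neg (run c m n))).
Proof.
exact: recursive_op_iter (recursive_op_Neg (recursive_op_run_context c m))
  (recursive_op_count_step _ _).
Qed.

(** * Membership in the language fragment *)

Notation fragment := (in_fragment x y P p).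

Lemma fragment_Imp A B : fragment A -> fragment B -> fragment (Imp A B).
Proof.
move=> [vA lA] [vB lB].
by split=> z /=; rewrite mem_cat => /orP[]; [apply: vA|apply: vB|apply: lA|apply: lB].
Qed.

Lemma fragment_All u A : u \in [:: x; y] -> fragment A -> fragment (All u A).
Proof.
move=> ux [vA lA]; split=> // z; rewrite /= inE => /orP[/eqP->//|].
exact: vA.
Qed.

Lemma fragment_Top : fragment Top. Proof. by []. Qed.

Lemma fragment_Box A : fragment A -> fragment (Box A). Proof. by []. Qed.

Lemma fragment_Neg A : fragment A -> fragment (Neg A).
Proof. by move=> fA; apply: fragment_Imp. Qed.

Lemma fragment_And A B : fragment A -> fragment B -> fragment (And A B).
Proof.
by move=> fA fB; apply: fragment_Neg; apply: fragment_Imp => //; apply: fragment_Neg.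
Qed.

Lemma fragment_Dia A : fragment A -> fragment (Dia A).
Proof. by move=> /fragment_Neg fA; apply: fragment_Neg. Qed.

Lemma fragment_Ex u A : u \in [:: x; y] -> fragment A -> fragment (Ex u A).
Proof. by move=> ux fA; apply/fragment_Neg/fragment_All/fragment_Neg. Qed.

Lemma fragment_bigAnd (T : eqType) (f : T -> form) s :
  (forall t, t \in s -> fragment (f t)) -> fragment (bigAnd [seq f t | t <- s]).
Proof.
elim: s => // t s IHs fs; apply: fragment_And; first by apply/fs/mem_head.
by apply: IHs => t' st'; apply: fs; rewrite inE st' orbT.
Qed.

Lemma fragment_marker : fragment marker.
Proof. by split=> // z; rewrite !inE => ->; rewrite orbT. Qed.

Lemma fragment_patom u : u \in [:: x; y] -> fragment (patom u).
Proof. by move=> ux; split=> z; rewrite /= inE => /eqP->; last exact: mem_head. Qed.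

Hint Resolve fragment_Imp fragment_Box fragment_Top fragment_Neg fragment_And
  fragment_Dia fragment_marker fragment_patom : core.

Lemma x_in : x \in [:: x; y]. Proof. exact: mem_head. Qed.
Lemma y_in : y \in [:: x; y]. Proof. by rewrite !inE eqxx orbT. Qed.
Hint Resolve x_in y_in : core.

Lemma fragment_rank j u v : u \in [:: x; y] -> v \in [:: x; y] -> fragment (rank j u v).
Proof.
elim: j u v => [|j IHj] u v ux vx; first by apply: fragment_Dia; auto.
by apply: fragment_Dia; do 2![apply: fragment_And; first by auto];
  apply: fragment_Ex => //; auto.
Qed.

Lemma fragment_tag_form j : fragment (tag_form j).
Proof.
by apply: fragment_And; [|apply: fragment_Neg]; apply: fragment_Ex => //;
  apply: fragment_And; auto; apply: fragment_rank.
Qed.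
Hint Resolve fragment_tag_form : core.

Lemma fragment_count_step i u A :
  u \in [:: x; y] -> fragment A -> fragment (count_step i u A).
Proof. by move=> ux fA; rewrite /count_step /in_reg; auto 10. Qed.
Hint Resolve fragment_count_step : core.

Lemma fragment_in_state q u : u \in [:: x; y] -> fragment (in_state q u).
Proof. by move=> ux; rewrite /in_state /special; auto 10. Qed.
Hint Resolve fragment_in_state : core.

Lemma fragment_update o u v i :
  u \in [:: x; y] -> v \in [:: x; y] -> fragment (update o u v i).
Proof.
have inc u' v' : u' \in [:: x; y] -> v' \in [:: x; y] -> fragment (incremented i u' v').
  move=> ux vx; have extra_f : fragment (extra i u' v') by rewrite /extra /in_reg; auto.
  have tag_f : fragment (in_reg i u') by rewrite /in_reg; auto.
  have later_f : fragment (extra_later i u' v') by rewrite /extra_later; auto.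
  by rewrite /incremented /bigAnd /=; auto 20.
have same : u \in [:: x; y] -> v \in [:: x; y] -> fragment (unchanged i u v).
  by move=> ux vx; rewrite /unchanged; auto 10.
by move=> ux vx; case: o => [|j|j|j] /=; try case: ifP; auto.
Qed.

Lemma fragment_run c m n : fragment (run c m n).
Proof.
have iter_f : fragment (iter n (count_step 0 x) Top) by elim: n => //= n; auto.
apply: fragment_And.
  apply: fragment_And; last by apply: fragment_All; auto.
  apply: fragment_bigAnd => k _; apply: fragment_bigAnd => -[o k'] _.
  apply: fragment_All => //; apply: fragment_Imp; auto.
  apply: fragment_Imp; first by case: o => //=; auto.
  apply: fragment_Ex => //; apply: fragment_And; auto.
  by apply: fragment_bigAnd => i _; apply: fragment_update.
apply: fragment_Ex => //; apply: fragment_And; auto; apply: fragment_And; auto.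
by apply: fragment_bigAnd => i _; auto.
Qed.

End Formulas.

(** * Meaning of the formula *)

Section Meaning.

Variables (W D : Type) (R : W -> W -> Prop) (dom : W -> D -> Prop).
Variables (pr : W -> D -> Prop) (mk : W -> Prop).

(** From here on each formula gets a counterpart free of syntax and assignments. Both directions of
    the reduction are proved for these counterparts. *)
Definition Special (w : W) (d : D) : Prop := exists v, R w v /\ mk v /\ pr v d.

Fixpoint Rank (j : nat) (w : W) (d : D) : Prop :=
  match j with
  | 0 => Special w d
  | j.+1 => exists v, R w v /\ mk v /\ pr v d /\
              exists e, dom v e /\ Rank j v e /\ ~ pr v e
  end.

Definition Tag (j : nat) (w : W) : Prop :=
  (exists d, dom w d /\ Rank j w d /\ pr w d) /\
  ~ (exists d, dom w d /\ Rank j.+1 w d /\ pr w d).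

Definition In_reg (i : nat) (w : W) (d : D) : Prop := Tag (reg_tag i) w /\ pr w d.

Definition Count_step (i : nat) (d : D) (A : W -> Prop) (w : W) : Prop :=
  exists v, R w v /\ mk v /\ exists u, R v u /\ In_reg i u d /\ A u.

Definition At_least (i n : nat) (d : D) : W -> Prop :=
  iter n (Count_step i d) (fun=> True).

Definition In_state (q : nat) (w : W) (d : D) : Prop :=
  ~ Special w d /\ exists v, R w v /\ Tag q v /\ pr v d.

Definition Extra (i : nat) (w : W) (d e : D) : Prop := In_reg i w e /\ ~ pr w d.

Definition Extra_later (i : nat) (w : W) (d e : D) : Prop :=
  exists v, R w v /\ mk v /\ exists u, R v u /\ Extra i u d e.

Definition Incremented (i : nat) (w : W) (d e : D) : Prop :=
  (forall v, R w v -> In_reg i v d -> pr v e) /\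
  Extra_later i w d e /\
  (forall v, R w v -> In_reg i v d -> Extra_later i v d e) /\
  (forall v, R w v -> Extra i v d e -> forall u, R v u -> ~ In_reg i u d) /\
  (forall v, R w v -> Extra i v d e -> forall u, R v u -> mk u ->
     forall t, R u t -> ~ Extra i t d e).

Definition Unchanged (i : nat) (w : W) (d e : D) : Prop :=
  forall v, R w v -> Tag (reg_tag i) v -> (pr v d -> pr v e) /\ (pr v e -> pr v d).

Definition Guard (o : op) (w : W) (d : D) : Prop :=
  match o with
  | Dec j => At_least j 1 d w
  | Zero j => ~ At_least j 1 d w
  | _ => True
  end.

Definition Update (o : op) (w : W) (d e : D) (i : nat) : Prop :=
  match o with
  | Inc j => if i == j then Incremented i w d e else Unchanged i w d e
  | Dec j => if i == j then Incremented i w e d else Unchanged i w d e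
  | _ => Unchanged i w d e
  end.

Definition Rule (c : cmd) (m : nat) (w : W) (k : seq cmd) (t : op * seq cmd) : Prop :=
  forall d, dom w d -> In_state (state_tag c k) w d -> Guard t.1 w d ->
  exists e, dom w e /\ In_state (state_tag c t.2) w e /\
    forall i, i \in iota 0 m.+1 -> Update t.1 w d e i.

Definition Run (c : cmd) (m n : nat) (w : W) : Prop :=
  ((forall k, k \in states c -> forall t, t \in transitions k -> Rule c m w k t) /\
   forall d, dom w d -> ~ In_state (state_tag c [::]) w d) /\
  exists d, dom w d /\
    (In_state (state_tag c [:: c]) w d /\
     forall i, i \in iota 1 m -> ~ At_least i 1 d w) /\
    At_least 0 n d w /\ ~ At_least 0 n.+1 d w.

End Meaning.

Definition holds1 (W : Type) (R : W -> W -> Prop) (F : pred_frame R)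
  (I : interpretation F) (P : nat) (w : W) (d : carrier F) : Prop :=
  holds I w P [tuple d].

Definition holds0 (W : Type) (R : W -> W -> Prop) (F : pred_frame R)
  (I : interpretation F) (p : nat) (w : W) : Prop := holds I w p [tuple].

Section Satisfaction.

Variables (W : Type) (R : W -> W -> Prop) (F : pred_frame R) (I : interpretation F).
Variables (x y P p : nat) (x_neq_y : x <> y).

Notation D := (carrier F).
Notation dom := (dom F).
Notation sat := (sat I).
Notation pr := (holds1 I P).
Notation mk := (holds0 I p).

Lemma sat_Top w g : sat w g Top <-> True.
Proof. by split=> // _ []. Qed.

Lemma sat_Imp w g A B : sat w g (Imp A B) <-> (sat w g A -> sat w g B).
Proof. by []. Qed.

Lemma sat_Neg w g A : sat w g (Neg A) <-> ~ sat w g A.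
Proof. by []. Qed.

Lemma sat_Box w g A : sat w g (Box A) <-> forall v, R w v -> sat v g A.
Proof. by []. Qed.

Lemma sat_Box_Imp w g A B (SA SB : W -> Prop) :
  (forall v, sat v g A <-> SA v) -> (forall v, sat v g B <-> SB v) ->
  sat w g (Box (Imp A B)) <-> forall v, R w v -> SA v -> SB v.
Proof.
by move=> eA eB; split=> sAB v wv /eA sA; apply/eB/sAB.
Qed.

Lemma sat_And w g A B : sat w g (And A B) <-> sat w g A /\ sat w g B.
Proof.
split=> [nAB|[sA sB] nAB]; last exact: nAB sA sB.
by split; apply: NNPP => nA; apply: nAB => //= sA.
Qed.

Lemma sat_Dia w g A : sat w g (Dia A) <-> exists v, R w v /\ sat v g A.
Proof.
split=> [nA|[v [wv vA]] nA]; last exact: nA wv vA.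
by apply: NNPP => nE; apply: nA => v wv vA; apply: nE; exists v.
Qed.

Lemma sat_All w g z A :
  sat w g (All z A) <-> forall d, dom w d -> sat w (upd g z d) A.
Proof.
split=> [sA d wd|sA g' gg' wd].
  by apply: sA => [u /eqP uz|]; [rewrite upd_neq|rewrite upd_eq].
have -> : g' = upd g z (g' z); last exact: sA.
apply: functional_extensionality => u; rewrite /upd.
by case: eqP => [->//|/gg'].
Qed.

Lemma sat_Ex w g z A :
  sat w g (Ex z A) <-> exists d, dom w d /\ sat w (upd g z d) A.
Proof.
rewrite /Ex sat_Neg sat_All; split=> [nA|[d [wd dA]] nA]; last exact: nA wd dA.
by apply: NNPP => nE; apply: nA => d wd dA; apply: nE; exists d.
Qed.

Lemma sat_bigAnd (T : eqType) w g (f : T -> form) s :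
  sat w g (bigAnd [seq f t | t <- s]) <-> forall t, t \in s -> sat w g (f t).
Proof.
elim: s => [|t s IHs]; first by split=> // _ [].
rewrite -[bigAnd _]/(And (f t) (bigAnd (map f s))) sat_And IHs.
split=> [[ft fs] t'|fs].
  by rewrite inE => /orP[/eqP->//|]; apply: fs.
by split=> [|t' st']; apply: fs; rewrite inE ?eqxx ?st' ?orbT.
Qed.

Lemma sat_marker w g : sat w g (marker p) <-> mk w.
Proof.
by rewrite /holds0 /= (_ : map_tuple g _ = [tuple]) //; apply: val_inj.
Qed.

Lemma sat_patom w g u : sat w g (patom P u) <-> pr w (g u).
Proof.
by rewrite /holds1 /= (_ : map_tuple g _ = [tuple g u]) //; apply: val_inj.
Qed.

Lemma sat_special w g u : sat w g (special P p u) <-> Special R pr mk w (g u).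
Proof.
rewrite sat_Dia; setoid_rewrite sat_And; setoid_rewrite sat_marker.
by setoid_rewrite sat_patom.
Qed.

(** The two variables are reused alternately: each level rebinds the one whose value is no longer
    read. Hence the induction is for all [u] and [v], and the value of [v] does not affect the
    right-hand side. *)
Lemma sat_rank j u v w g : u != v ->
  sat w g (rank P p j u v) <-> Rank R dom pr mk j w (g u).
Proof.
elim: j u v w g => [|j IHj] u v w g uv; first exact: sat_special.
rewrite sat_Dia; setoid_rewrite sat_And; setoid_rewrite sat_marker.
setoid_rewrite sat_And; setoid_rewrite sat_patom; setoid_rewrite sat_Ex.
setoid_rewrite sat_And; setoid_rewrite sat_Neg; setoid_rewrite sat_patom.
have vu : v != u by rewrite eq_sym.
have e t d : sat t (upd g v d) (rank P p j v u) <-> Rank R dom pr mk j t d.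
  by rewrite IHj // upd_eq.
by setoid_rewrite e; setoid_rewrite upd_eq.
Qed.

Lemma sat_tag_form j w g : sat w g (tag_form x y P p j) <-> Tag R dom pr mk j w.
Proof.
have xy : x != y by apply/eqP.
have e i t d : sat t (upd g x d) (rank P p i x y) <-> Rank R dom pr mk i t d.
  by rewrite sat_rank // upd_eq.
rewrite sat_And sat_Neg !sat_Ex; setoid_rewrite sat_And.
by setoid_rewrite e; setoid_rewrite sat_patom; setoid_rewrite upd_eq.
Qed.

Lemma sat_in_reg i u w g :
  sat w g (in_reg x y P p i u) <-> In_reg R dom pr mk i w (g u).
Proof. by rewrite sat_And sat_tag_form sat_patom. Qed.

Lemma sat_count_step i u A w g : sat w g (count_step x y P p i u A) <->
  Count_step R dom pr mk i (g u) (fun v => sat v g A) w.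
Proof.
rewrite sat_Dia; setoid_rewrite sat_And; setoid_rewrite sat_marker.
setoid_rewrite sat_Dia; setoid_rewrite sat_And.
by setoid_rewrite sat_in_reg.
Qed.

Lemma sat_at_least i u n w g :
  sat w g (iter n (count_step x y P p i u) Top) <->
  At_least R dom pr mk i n (g u) w.
Proof.
elim: n w => [|n IHn] w; first exact: sat_Top.
by rewrite /At_least !iterS sat_count_step /Count_step; setoid_rewrite IHn.
Qed.

Lemma sat_in_state q u w g :
  sat w g (in_state x y P p q u) <-> In_state R dom pr mk q w (g u).
Proof.
rewrite sat_And sat_Neg sat_special sat_Dia; setoid_rewrite sat_And.
by setoid_rewrite sat_tag_form; setoid_rewrite sat_patom.
Qed.

Lemma sat_extra i u v w g :
  sat w g (extra x y P p i u v) <-> Extra R dom pr mk i w (g u) (g v).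
Proof. by rewrite sat_And sat_Neg sat_patom sat_in_reg. Qed.

Lemma sat_extra_later i u v w g :
  sat w g (extra_later x y P p i u v) <-> Extra_later R dom pr mk i w (g u) (g v).
Proof.
rewrite sat_Dia; setoid_rewrite sat_And; setoid_rewrite sat_marker.
by setoid_rewrite sat_Dia; setoid_rewrite sat_extra.
Qed.

Lemma sat_incremented i u v w g : sat w g (incremented x y P p i u v) <->
  Incremented R dom pr mk i w (g u) (g v).
Proof.
have e1 t : sat t g (in_reg x y P p i u) <-> In_reg R dom pr mk i t (g u).
  exact: sat_in_reg.
have e2 t : sat t g (patom P v) <-> pr t (g v) by apply: sat_patom.
have e3 t : sat t g (extra_later x y P p i u v) <->
    Extra_later R dom pr mk i t (g u) (g v) by apply: sat_extra_later.
have e4 t : sat t g (extra x y P p i u v) <-> Extra R dom pr mk i t (g u) (g v).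
  exact: sat_extra.
have e5 t : sat t g (Box (Neg (in_reg x y P p i u))) <->
    forall s, R t s -> ~ In_reg R dom pr mk i s (g u).
  by rewrite sat_Box; setoid_rewrite sat_Neg; setoid_rewrite e1.
have e6 t : sat t g (Box (Neg (extra x y P p i u v))) <->
    forall s, R t s -> ~ Extra R dom pr mk i s (g u) (g v).
  by rewrite sat_Box; setoid_rewrite sat_Neg; setoid_rewrite e4.
have e7 t : sat t g (Box (Imp (marker p) (Box (Neg (extra x y P p i u v))))) <->
    forall s, R t s -> mk s ->
    forall r, R s r -> ~ Extra R dom pr mk i r (g u) (g v).
  by apply: sat_Box_Imp e6 => s; apply: sat_marker.
rewrite /incremented /bigAnd [foldr _ _ _]/= !sat_And sat_Top e3.
rewrite (sat_Box_Imp _ e1 e2) (sat_Box_Imp _ e1 e3) (sat_Box_Imp _ e4 e5).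
rewrite (sat_Box_Imp _ e4 e7) /Incremented; tauto.
Qed.

Lemma sat_unchanged i u v w g : sat w g (unchanged x y P p i u v) <->
  Unchanged R dom pr mk i w (g u) (g v).
Proof.
apply: sat_Box_Imp => t; first exact: sat_tag_form.
by rewrite sat_And !sat_Imp !sat_patom.
Qed.

Lemma sat_guard o u w g :
  sat w g (guard x y P p o u) <-> Guard R dom pr mk o w (g u).
Proof.
case: o => [|j|j|j]; [exact: sat_Top|exact: sat_Top| |].
  exact: (sat_at_least j u 1).
by rewrite sat_Neg (sat_at_least j u 1).
Qed.

Lemma sat_update o u v i w g : sat w g (update x y P p o u v i) <->
  Update R dom pr mk o w (g u) (g v) i.
Proof.
by case: o => [|j|j|j]; rewrite /update /Update; try case: (i == j);
  rewrite ?sat_incremented ?sat_unchanged.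
Qed.

Lemma sat_rule c m k t w g : sat w g (rule x y P p c m k t) <->
  Rule R dom pr mk c m w k t.
Proof.
have xy : x != y by apply/eqP.
rewrite sat_All; split=> sR d wd.
  move: (sR d wd); rewrite sat_Imp sat_in_state sat_Imp sat_guard upd_eq => sRd dq dt.
  move: (sRd dq dt); rewrite sat_Ex => -[e [we]].
  rewrite sat_And sat_in_state sat_bigAnd upd_eq => -[eq' eu].
  exists e; split=> //; split=> // i /eu/sat_update.
  by rewrite upd_neq ?upd_eq.
rewrite sat_Imp sat_in_state sat_Imp sat_guard upd_eq => dq dt.
have [e [we [eq' eu]]] := sR d wd dq dt.
rewrite sat_Ex; exists e; split=> //.
rewrite sat_And sat_in_state sat_bigAnd upd_eq; split=> // i /eu ei.
by apply/sat_update; rewrite upd_neq ?upd_eq.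
Qed.

Lemma sat_run c m n w g :
  sat w g (run x y P p c m n) <-> Run R dom pr mk c m n w.
Proof.
have rulesE : sat w g (rules x y P p c m) <-> forall k, k \in states c ->
    forall t, t \in transitions k -> Rule R dom pr mk c m w k t.
  rewrite sat_bigAnd; split=> sR k /sR; rewrite sat_bigAnd => sk t /sk;
    exact: (proj1 (sat_rule _ _ _ _ _ _)) || exact: (proj2 (sat_rule _ _ _ _ _ _)).
have haltE : sat w g (All x (Neg (in_state x y P p (state_tag c [::]) x))) <->
    forall d, dom w d -> ~ In_state R dom pr mk (state_tag c [::]) w d.
  by rewrite sat_All; split=> sA d /sA; rewrite sat_Neg sat_in_state upd_eq.
have zeroE d : sat w (upd g x d)
      (bigAnd [seq Neg (count_step x y P p i x Top) | i <- iota 1 m]) <->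
    forall i, i \in iota 1 m -> ~ At_least R dom pr mk i 1 d w.
  by rewrite sat_bigAnd; split=> sA i /sA;
    rewrite sat_Neg (sat_at_least i x 1) upd_eq.
rewrite /run /run_context 2!sat_And rulesE haltE sat_Ex.
by split=> -[rh [d [wd sd]]]; split=> //; exists d; split=> //; move: sd;
  rewrite 2!sat_And sat_in_state zeroE sat_And sat_Neg -/(iter n.+1 _ _);
  rewrite sat_at_least (sat_at_least 0 x n.+1) upd_eq.
Qed.

End Satisfaction.

(** * Terminating programs have unsatisfiable formulas *)

Definition op_reg (o : op) : nat :=
  match o with Nop => 0 | Inc j | Dec j | Zero j => j end.

Fixpoint max_reg (c : cmd) : nat :=
  match c with
  | Op o => op_reg o
  | Seq c1 c2 => maxn (max_reg c1) (max_reg c2)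
  | Star c => max_reg c
  end.

Section Soundness.

Variables (W D : Type) (R : W -> W -> Prop) (dom : W -> D -> Prop).
Variables (pr : W -> D -> Prop) (mk : W -> Prop).
Hypothesis R_trans : forall u v w, R u v -> R v w -> R u w.
Variable w0 : W.

Notation in_reg := (In_reg R dom pr mk).
Notation at_least := (At_least R dom pr mk).
Notation in_state := (In_state R dom pr mk).

(** The root is added by hand because [R] need not be reflexive. *)
Definition reachable (w : W) : Prop := w = w0 \/ R w0 w.

Lemma reachable_step v w : reachable v -> R v w -> R w0 w.
Proof. by case=> [->//|]; apply: R_trans. Qed.

Lemma at_least_pred i n d w : at_least i n.+1 d w -> at_least i n d w.
Proof.
elim: n w => // n IHn w [v [wv [mv [u [vu [du /IHn un]]]]]].
by exists v; split=> //; split=> //; exists u.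
Qed.

Lemma at_least_leq i m n d w : m <= n -> at_least i n d w -> at_least i m d w.
Proof.
elim: n => [|n IHn]; first by rewrite leqn0 => /eqP->.
by rewrite leq_eqVlt => /orP[/eqP->//|/IHn le_mn /at_least_pred].
Qed.

Lemma at_least_unchanged i n d e w : Unchanged R dom pr mk i w0 d e ->
  reachable w -> at_least i n d w <-> at_least i n e w.
Proof.
move=> de; elim: n w => // n IHn w rw.
by split=> -[v [wv [mv [u [vu [[tu du] un]]]]]];
  have w0v := reachable_step rw wv; have w0u := R_trans w0v vu;
  exists v; split=> //; split=> //; exists u; split=> //;
  have [de1 ed1] := de u w0u tu; split; [split=> //; auto|apply/IHn; [right|]|
  split=> //; auto|apply/IHn; [right|]].
Qed.

(** The worlds counted for [d] are counted for [e] too, and a further extra world of [e] comes after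
    the last of them, or after the root if there are none. The condition on [w] is what allows
    [Extra_later] to be invoked there. *)
Lemma at_least_incremented i n d e w : Incremented R dom pr mk i w0 d e ->
  (w = w0 \/ R w0 w /\ in_reg i w d) -> at_least i n d w -> at_least i n.+1 e w.
Proof.
move=> [de [de0 [de1 _]]]; elim: n w => [|n IHn] w rw.
  have [v [wv [mv [u [vu [eu _]]]]]] : Extra_later R dom pr mk i w d e.
    by case: rw => [->//|[w0w dw]]; apply: de1.
  by move=> _; exists v; split=> //; split=> //; exists u.
move=> [v [wv [mv [u [vu [du un]]]]]].
have w0v : R w0 v by case: rw => [<-//|[w0w _]]; apply: R_trans wv.
have w0u := R_trans w0v vu.
exists v; split=> //; split=> //; exists u; split=> //; split.
  by split; [case: du|apply: de].
by apply: IHn => //; right.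
Qed.

(** In a separated sequence of worlds counted for [e], only the last can be extra: beyond an extra
    world nothing is counted for [d], and behind a later marker nothing is extra. Dropping the last
    world leaves a sequence counted for [d]. *)
Lemma at_least_incremented_inv i n d e w : Incremented R dom pr mk i w0 d e ->
  reachable w -> at_least i n.+1 e w -> at_least i n d w.
Proof.
move=> [de [_ [_ [de2 de3]]]]; elim: n w => // n IHn w rw.
move=> [v [wv [mv [u [vu [eu un]]]]]].
have w0v := reachable_step rw wv; have w0u := R_trans w0v vu.
have [du|ndu] := classic (pr u d).
  exists v; split=> //; split=> //; exists u; split=> //; split.
    by split; [case: eu|].
  by apply: IHn; [right|].
case: un => v' [uv' [mv' [u' [vu' [eu' _]]]]]; exfalso.
apply: (de3 u w0u (conj eu ndu) v' uv' mv' u' vu'); split=> // du'.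
by apply: (de2 u w0u (conj eu ndu) u' (R_trans uv' vu')); split=> //; case: eu'.
Qed.

Variables (c0 : cmd) (m n : nat).
Hypothesis w0_run : Run R dom pr mk c0 m n w0.

(** Registers are read through their lower bounds, because the count of an element of an arbitrary
    model may be infinite. *)
Definition encodes (d : D) (k : seq cmd) (s : nat -> nat) : Prop :=
  [/\ dom w0 d, in_state (state_tag c0 k) w0 d
    & forall i, i \in iota 0 m.+1 -> forall q, at_least i q d w0 <-> q <= s i].

Lemma encodes_step d k s o k' s' : k \in states c0 -> (o, k') \in transitions k ->
  op_reg o <= m -> encodes d k s -> op_sem o s s' -> exists e, encodes e k' s'.
Proof.
move=> kc kk' om [wd kd sd] ss'; have [[rules _] _] := w0_run.
have om' : op_reg o \in iota 0 m.+1 by rewrite mem_iota.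
have [|e [we [ke ue]]] := rules _ kc _ kk' d wd kd.
  case: o om' ss' {kk' om} => //= j jm.
    by case=> sj _; apply/(sd j jm 1).
  by case=> sj _ /(sd j jm 1); rewrite sj.
exists e; split=> // i im q; have {ue} := ue i im.
have same : Unchanged R dom pr mk i w0 d e -> s' i = s i ->
    at_least i q e w0 <-> q <= s' i.
  by move=> de ->; rewrite -sd //; symmetry;
    apply: (at_least_unchanged _ de); left.
case: o om' ss' {kk' om ke} => [|j|j|j] /= jm.
- by move=> ss' de; apply: same; rewrite ?ss'.
- move=> ss'; case: eqP => [ij|/eqP ij] de; last by apply: same; rewrite ?ss' ?upd_neq.
  rewrite ss' -ij upd_eq; case: q {same} => [|q] //.
  rewrite ltnS -sd //; split; first by apply: at_least_incremented_inv; [|left].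
  by apply: at_least_incremented; [|left].
- move=> [sj ss']; case: eqP => [ij|/eqP ij] de.
    rewrite ss' -ij upd_eq (_ : (q <= _) = (q < s i)); last by rewrite ij; lia.
    rewrite -sd //; split; first by apply: at_least_incremented; [|left].
    by apply: at_least_incremented_inv; [|left].
  by apply: same; rewrite ?ss' ?upd_neq.
by move=> [_ ss'] de; apply: same; rewrite ?ss'.
Qed.

(** The rules follow single transitions, whereas [cmd_sem] describes whole executions. The two are
    matched by induction on [c] for every continuation [k], with an inner induction on the
    iterations of a [Star]. *)
Lemma encodes_exec c k s s' d :
  {subset conts c k <= states c0} -> max_reg c <= m ->
  encodes d (c :: k) s -> cmd_sem c s s' -> exists e, encodes e k s'.
Proof.
elim: c k s s' d => [o|c1 IH1 c2 IH2|c IHc] k s s' d kc cm ds ss'.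
- by apply: encodes_step ds ss' => //; [apply/kc/mem_head|apply: mem_head].
- case: ss' => t st ts'; move: cm; rewrite geq_max => /andP[c1m c2m].
  have [|d1 d1s] := encodes_step (o := Nop) (kc _ (mem_head _ _)) (mem_head _ _)
    _ ds erefl; first by [].
  have [|d2 d2t] := IH1 _ _ _ _ _ c1m d1s st.
    by move=> k' k1; apply: kc; rewrite /= inE mem_cat k1 orbT.
  by apply: IH2 c2m d2t ts' => k' k2; apply: kc; rewrite /= inE mem_cat k2 !orbT.
elim: ss' d ds => {s s'} [s|s t s' st _ IHs] d ds.
  by apply: (encodes_step (kc _ (mem_head _ _)) (mem_head _ _) _ ds).
have [||d1 d1s] := encodes_step (o := Nop) (k' := [:: c, Star c & k])
  (kc _ (mem_head _ _)) _ _ ds erefl.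
- by rewrite !inE eqxx orbT.
- by [].
have [|d2 d2t] := IHc _ _ _ _ _ cm d1s st.
  by move=> k' k1; apply: kc; rewrite /= inE k1 orbT.
exact: IHs d2t.
Qed.

Lemma run_not_halting s : max_reg c0 <= m -> ~ cmd_sem c0 (input n) s.
Proof.
move=> c0m c0s; have [[_ halt] [d [wd [[kd zd] [nd Nnd]]]]] := w0_run.
have [||e [we ke _]] := @encodes_exec c0 [::] (input n) s d _ c0m _ c0s.
- by move=> k kc; rewrite inE kc orbT.
- split=> // i; rewrite inE => /orP[/eqP->|i1] q; rewrite /input.
    rewrite upd_eq; split=> [qd|qn]; last exact: at_least_leq nd.
    by rewrite leqNgt; apply/negP => nq; apply/Nnd/(at_least_leq nq).
  rewrite upd_neq; last by move: i1; rewrite mem_iota; lia.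
  case: q => // q; split=> // dq; exfalso.
  by apply: (zd i i1); apply: at_least_leq dq.
exact: halt ke.
Qed.

End Soundness.

(** * The model of a nonterminating program *)

Fixpoint conts_sem (k : seq cmd) (s s' : nat -> nat) : Prop :=
  match k with
  | [::] => s' = s
  | c :: k => exists2 t, cmd_sem c s t & conts_sem k t s'
  end.

Lemma conts_closed c k0 k t : k \in conts c k0 -> t \in transitions k ->
  t.2 \in k0 :: conts c k0.
Proof.
elim: c k0 => [o|c1 IH1 c2 IH2|c IHc] k0 /=.
- by rewrite inE => /eqP->; rewrite /= inE => /eqP->; apply: mem_head.
- rewrite inE mem_cat => /or3P[/eqP->|/IH1{}IH1 /IH1|/IH2{}IH2 /IH2].
  + rewrite /= inE => /eqP->; rewrite /= !inE mem_cat.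
    by case: (c1) => *; rewrite /= mem_head !orbT.
  + rewrite !inE mem_cat => /orP[/eqP->|->]; last by rewrite !orbT.
    by case: (c2) => *; rewrite /= mem_head !orbT.
  by rewrite !inE mem_cat => /orP[->|->]; rewrite ?orbT.
rewrite inE => /orP[/eqP->|/IHc{}IHc /IHc].
  rewrite /= !inE => /orP[/eqP->|/eqP->]; first by rewrite /= eqxx.
  by case: (c) => *; rewrite /= mem_head !orbT.
by rewrite !inE => /orP[->|->]; rewrite ?orbT.
Qed.

Lemma states_closed c k t :
  k \in states c -> t \in transitions k -> t.2 \in states c.
Proof. by rewrite inE => /orP[/eqP->//|]; apply: conts_closed. Qed.

(** Used contrapositively: a transition from a configuration without terminating runs leads to
    another such configuration, so the domain of the model provides the witnesses that the rules
    demand. *)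
Lemma conts_sem_step k t s s1 s' : t \in transitions k -> op_sem t.1 s s1 ->
  conts_sem t.2 s1 s' -> conts_sem k s s'.
Proof.
case: k => [|[o|c1 c2|c] k] //=.
- by rewrite inE => /eqP-> /= ss1; exists s1.
- rewrite inE => /eqP-> /= -> [u su [v uv vs']].
  by exists v => //; exists u.
rewrite !inE => /orP[]/eqP-> /= -> ss'; first by exists s => //; apply: star_refl.
case: ss' => u su [v uv vs']; exists v => //.
exact: star_step uv.
Qed.

Section Model.

Variables (W : Type) (lt R : W -> W -> Prop) (ch : nat -> W).
Hypothesis lt_order : strict_linear_order lt.
Hypothesis ch_step : forall i, lt (ch i) (ch i.+1).
Hypothesis lt_sub_R : forall u v, lt u v -> R u v.
Hypothesis R_sub_le : forall u v, R u v -> lt u v \/ u = v.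

Lemma ch_lt i j : i < j -> lt (ch i) (ch j).
Proof.
have [_ trans _] := lt_order.
elim: j => // j IHj; rewrite ltnS leq_eqVlt => /orP[/eqP->//|/IHj ij].
exact: trans ij (ch_step j).
Qed.

Lemma R_ch i j : i < j -> R (ch i) (ch j).
Proof. by move/ch_lt/lt_sub_R. Qed.

Lemma R_ch_leq i j : R (ch i) (ch j) -> i <= j.
Proof.
have [irrefl trans _] := lt_order => /R_sub_le rij; rewrite leqNgt.
apply/negP => /ch_lt ji; case: rij => [/trans/(_ ji)|eij]; first exact: irrefl.
by apply: (irrefl (ch j)); rewrite eij in ji *.
Qed.

Lemma ch_inj : injective ch.
Proof.
have [irrefl _ _] := lt_order => i j eij.
by case: (ltngtP i j) => // /ch_lt; rewrite eij => /irrefl.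
Qed.

(** This pairing spreads the kinds [j] along the chain: it is injective, increasing in [b] for fixed
    [j], and greater than [b], so every kind recurs beyond every point. *)
Definition slot (j b : nat) : nat := CodeSeq.code [:: j; b].

Lemma slot_inj j b j' b' : slot j b = slot j' b' -> j = j' /\ b = b'.
Proof. by move/(can_inj CodeSeq.codeK) => -[]. Qed.

Lemma slotE j b : slot j b = 2 ^ j * (2 ^ b).*2.+1.
Proof. by rewrite /slot /CodeSeq.code /= muln1. Qed.

Lemma slot_lt j b b' : (slot j b < slot j b') = (b < b').
Proof.
by rewrite !slotE ltn_pmul2l ?expn_gt0 // ltnS ltn_double ltn_exp2l.
Qed.

Lemma slot_gt j b : b < slot j b.
Proof.
rewrite slotE; apply: (@leq_trans (2 ^ b).*2.+1).
  by have := ltn_expl b (isT : 1 < 2); lia.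
by rewrite leq_pmull ?expn_gt0.
Qed.

(** A slot occupies two consecutive worlds of the chain, a marker at the even position and a tag
    world at the odd one. Hence distinct tag worlds always have a marker between them. *)
Definition mark_world (j b : nat) : W := ch (slot j b).*2.
Definition tag_world (j b : nat) : W := ch (slot j b).*2.+1.

Lemma mark_world_inj j b j' b' :
  mark_world j b = mark_world j' b' -> j = j' /\ b = b'.
Proof. by move/ch_inj/double_inj/slot_inj. Qed.

Lemma tag_world_inj j b j' b' :
  tag_world j b = tag_world j' b' -> j = j' /\ b = b'.
Proof. by move/ch_inj => [] /double_inj/slot_inj. Qed.

Lemma tag_mark_neq j b j' b' : tag_world j b <> mark_world j' b'.
Proof. by move/ch_inj; lia. Qed.

Variables (c0 : cmd).

Notation elt := (nat + seq cmd * (nat -> nat))%type.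

Definition alive (k : seq cmd) (s : nat -> nat) : Prop :=
  k \in states c0 /\ ~ exists s', conts_sem k s s'.

Definition model_dom (d : elt) : Prop :=
  match d with inl _ => True | inr (k, s) => alive k s end.

(* Worlds outside the chain satisfy no atom, so they have no tag and are
   irrelevant to the formula, whatever the order between and beyond the chain. *)
Definition model_mk (w : W) : Prop := exists j b, w = mark_world j b.

(** The conjunct [model_dom d] ensures the inclusion in the local domain that an [interpretation]
    must satisfy. *)
Definition model_pr (w : W) (d : elt) : Prop :=
  model_dom d /\
  match d with
  | inl i => (exists j b, w = mark_world j b /\ j <= i) \/
             (exists b, w = tag_world i b)
  | inr (k, s) => (exists b, w = tag_world (state_tag c0 k) b) \/
                  (exists i b, w = tag_world (reg_tag i) b /\ b < s i)
  end.

Notation dom := (fun _ : W => model_dom).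
Notation Rank := (Rank R dom model_pr model_mk).
Notation Tag := (Tag R dom model_pr model_mk).

Lemma pr_mark_special j b i : model_pr (mark_world j b) (inl i) <-> j <= i.
Proof.
split=> [[_ [[j' [b' [/mark_world_inj[-> _]]]]|[b']]]|ji].
- by [].
- by move/esym/tag_mark_neq.
by split=> //; left; exists j, b.
Qed.

Lemma pr_mark_run j b k s : ~ model_pr (mark_world j b) (inr (k, s)).
Proof.
by case=> _ [[b' /esym/tag_mark_neq]|[i [b' [/esym/tag_mark_neq]]]].
Qed.

Lemma pr_tag_special j b i : model_pr (tag_world j b) (inl i) <-> i = j.
Proof.
split=> [[_ [[j' [b' [/tag_mark_neq]]]|[b' /tag_world_inj[]]]]|->] //.
by split=> //; right; exists b.
Qed.

Lemma pr_reg_run i b k s :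
  model_pr (tag_world (reg_tag i) b) (inr (k, s)) <-> alive k s /\ b < s i.
Proof.
split=> [[ks [[b' /tag_world_inj[]]|[i' [b' [/tag_world_inj[ii' ->]]]]]]|[ks bs]].
- by rewrite /reg_tag /state_tag; lia.
- by have -> : i = i' by rewrite /reg_tag in ii'; lia.
by split=> //; right; exists i, b.
Qed.

Lemma pr_state_run k' b k s : model_pr (tag_world (state_tag c0 k') b) (inr (k, s)) <->
  alive k s /\ state_tag c0 k' = state_tag c0 k.
Proof.
split=> [[ks [[b' /tag_world_inj[]]|[i' [b' [/tag_world_inj[]]]]]]|[ks ->]] //.
- by rewrite /reg_tag /state_tag; lia.
by split=> //; left; exists b.
Qed.

(** A witness of rank [j + 1] for the element of index [i] is a marker of some kind [r]. Membership
    in [P] there gives [r <= i], and an element of index at least [j] outside [P] gives [j < r]. *)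
Lemma rank_special j w d : Rank j w d -> exists2 i, d = inl i & j <= i.
Proof.
elim: j w d => [|j IHj] w d.
  by case=> _ [_ [[j [b ->]]]]; case: d => [i|[k s] /pr_mark_run//]; exists i.
case=> _ [_ [[r [b ->]] []]]; case: d => [i|[k s] /pr_mark_run//].
move=> /pr_mark_special ri [e [_ [/IHj[i' -> ji'] Npr]]]; exists i => //.
apply: leq_trans ri; apply: leq_ltn_trans ji' _; rewrite ltnNge.
by apply/negP => /pr_mark_special.
Qed.

(** Markers of kind [j + 1] occur beyond every world of the chain, and they separate the index [j]
    from all larger ones. *)
Lemma special_rank j a i : j <= i -> Rank j (ch a) (inl i).
Proof.
have R_mark r b : R (ch b) (mark_world r b).
  by apply: R_ch; have := slot_gt r b; lia.
elim: j a i => [|j IHj] a i ji.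
  by exists (mark_world 0 a); rewrite pr_mark_special; do 2?split=> //; exists 0, a.
exists (mark_world j.+1 a); rewrite pr_mark_special; split=> //.
split; first by exists j.+1, a.
split=> //; exists (inl j); split=> //; split; first exact: IHj.
by rewrite pr_mark_special ltnn.
Qed.

Lemma tagE j w : Tag j w <-> exists b, w = tag_world j b.
Proof.
split=> [[[d [_ [/rank_special[i -> ji] [_ pw]]]] Nd]|[b ->]].
  case: pw => [[r [b [ew ri]]]|[b ew]].
    (* At a marker [P] is closed upwards in the index, so an element of rank [j + 1] can be chosen
       in it. *)
    case: Nd; exists (inl (maxn i j.+1)); split=> //; split.
      by rewrite ew; apply: special_rank; lia.
    by rewrite ew pr_mark_special; lia.
  (* At a tag world the only special element in [P] is the one whose index is the tag; an index
     above [j] would already have rank [j + 1]. *)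
  have [<-|jNi] := eqVneq i j; first by exists b.
  case: Nd; exists (inl i); split=> //; split.
    by rewrite ew; apply: special_rank; lia.
  by rewrite ew pr_tag_special.
split.
  exists (inl j); split=> //; split; first exact: special_rank.
  exact/pr_tag_special.
case=> d [_ [/rank_special[i -> ji] /pr_tag_special ij]].
by rewrite ij ltnn in ji.
Qed.

Notation in_reg := (In_reg R dom model_pr model_mk).
Notation at_least := (At_least R dom model_pr model_mk).

Lemma in_regE i w k s : alive k s -> in_reg i w (inr (k, s)) <->
  exists2 b, w = tag_world (reg_tag i) b & b < s i.
Proof.
move=> ks; split=> [[/tagE[b ->] /pr_reg_run[_ bs]]|[b -> bs]]; first by exists b.
by split; [apply/tagE; exists b|apply/pr_reg_run].
Qed.

(** By parity the marker differs from both tag worlds, so reflexive steps of [R] do not matter and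
    the slot strictly increases. *)
Lemma tag_mark_tag_lt i b b' v :
  R (tag_world i b) v -> model_mk v -> R v (tag_world i b') -> b < b'.
Proof.
move=> bv [j [b1 ev]]; rewrite ev in bv * => vb'.
rewrite -(slot_lt i); move: (R_ch_leq bv) (R_ch_leq vb'); lia.
Qed.

Lemma at_least_tag_world i q b k s : alive k s -> b < s i ->
  at_least i q (inr (k, s)) (tag_world (reg_tag i) b) -> b + q < s i.
Proof.
move=> ks; elim: q b => [|q IHq] b bs; first by rewrite addn0.
case=> v [bv [mv [u [vu []]]]].
move=> /(in_regE _ _ ks)[b' eu b's]; rewrite eu in vu *.
by move/(IHq _ b's); have := tag_mark_tag_lt bv mv vu; lia.
Qed.

Lemma at_least_root i q k s : alive k s ->
  at_least i q (inr (k, s)) (ch 0) <-> q <= s i.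
Proof.
move=> ks; split.
  case: q => // q [v [_ [_ [u [_ []]]]]] /(in_regE _ _ ks)[b -> bs].
  by move/(at_least_tag_world ks bs); lia.
(* The tag worlds number [b] to [b + q - 1] of register [i] are counted, from any world of the chain
   before the marker of slot [b]. *)
suff {q} H q b a : a < (slot (reg_tag i) b).*2 -> b + q <= s i ->
    at_least i q (inr (k, s)) (ch a).
  by move=> qs; apply: (H q 0); rewrite // double_gt0; apply: slot_gt.
elim: q b a => // q IHq b a ab bs.
exists (mark_world (reg_tag i) b); split; first exact: R_ch.
split; first by exists (reg_tag i), b.
exists (tag_world (reg_tag i) b); split; first exact: R_ch.
split; first by apply/(in_regE _ _ ks); exists b => //; lia.
apply: (IHq b.+1); last by lia.
by have := slot_lt (reg_tag i) b b.+1; lia.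
Qed.

Lemma in_state_run k' k s : alive k s -> k' \in states c0 ->
  In_state R dom model_pr model_mk (state_tag c0 k') (ch 0) (inr (k, s)) <-> k' = k.
Proof.
move=> ks k'c; split=> [[_ [v [_ [/tagE[b ->]]]]]|->].
  case/pr_state_run => _ /double_inj/(congr1 (nth [::] (states c0))).
  by rewrite !nth_index //; case: ks.
split; first by case=> v [_ [[j [b ->]] /pr_mark_run]].
exists (tag_world (state_tag c0 k) 0); split; first exact: R_ch.
by split; [apply/tagE; exists 0|apply/pr_state_run].
Qed.

Lemma in_state_special q i :
  ~ In_state R dom model_pr model_mk q (ch 0) (inl i).
Proof. by case=> Nsp _; apply: Nsp; apply: (@special_rank 0). Qed.

Lemma unchanged_run i k s k' s' : alive k s -> alive k' s' -> s' i = s i ->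
  Unchanged R dom model_pr model_mk i (ch 0) (inr (k, s)) (inr (k', s')).
Proof.
move=> ks ks' ss' v _ /tagE[b ->].
by rewrite !pr_reg_run ss'; tauto.
Qed.

Lemma incremented_run i k s k' s' : alive k s -> alive k' s' -> s' i = (s i).+1 ->
  Incremented R dom model_pr model_mk i (ch 0) (inr (k, s)) (inr (k', s')).
Proof.
move=> ks ks' ss'.
(* The tag world number [s i] is the only extra one; it comes, with its own marker just before it,
   after all worlds counted for [s]. *)
have extraE v : Extra R dom model_pr model_mk i v (inr (k, s)) (inr (k', s')) <->
    v = tag_world (reg_tag i) (s i).
  split=> [[/(in_regE _ _ ks')[b -> bs'] Nbs]|->]; last first.
    split; last by rewrite pr_reg_run ltnn => -[].
    by apply/(in_regE _ _ ks'); exists (s i); rewrite // ss'.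
  have [bs|sb] := ltnP b (s i); first by case: Nbs; apply/pr_reg_run.
  by have -> : b = s i by lia.
have laterP a : a < (slot (reg_tag i) (s i)).*2 ->
    Extra_later R dom model_pr model_mk i (ch a) (inr (k, s)) (inr (k', s')).
  move=> lt_a; exists (mark_world (reg_tag i) (s i)); split; first exact: R_ch.
  split; first by exists (reg_tag i), (s i).
  by exists (tag_world (reg_tag i) (s i)); split; [apply: R_ch|apply/extraE].
split; first move=> v _ /(in_regE _ _ ks)[b -> bs].
  by apply/pr_reg_run; rewrite ss'; split=> //; lia.
split.
  by apply: laterP; rewrite double_gt0; have := slot_gt (reg_tag i) (s i); lia.
split; first move=> v _ /(in_regE _ _ ks)[b -> bs].
  by apply: laterP; have := slot_lt (reg_tag i) b (s i); lia.
split=> v _ /extraE-> u.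
  move=> vu /(in_regE _ _ ks)[b eu bs]; rewrite eu in vu.
  by have := R_ch_leq vu; have := slot_lt (reg_tag i) b (s i); lia.
move=> vu mu t ut /extraE et; rewrite et in ut.
by have := tag_mark_tag_lt vu mu ut; rewrite ltnn.
Qed.

Lemma run_model m n : ~ (exists s, cmd_sem c0 (input n) s) ->
  Run R dom model_pr model_mk c0 m n (ch 0).
Proof.
move=> Nhalt; split; first split.
- move=> k kc t tk [i _ /in_state_special//|[k1 s]] ks.
  move=> /(in_state_run ks kc) ek; rewrite -ek {k1 ek} in ks * => gt.
  (* The guard, evaluated at the root, says precisely that the operation can be executed. *)
  have [s' ss'] : exists s', op_sem t.1 s s'.
    case: (t.1) gt => [|j|j|j] /=; first by exists s.
    + by exists (upd s j (s j).+1).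
    + move=> /(at_least_root j 1 ks) sj.
      by exists (upd s j (s j).-1).
    + move=> Nj; exists s; split=> //; have [//|sj] := posnP (s j); case: Nj.
      exact/(at_least_root j 1 ks).
  have ks' : alive t.2 s'.
    split; first exact: states_closed kc tk.
    case=> u ku; case: ks => _ []; exists u; exact: conts_sem_step tk ss' ku.
  exists (inr (t.2, s')); split=> //; split.
    by apply/(in_state_run ks') => //; case: ks'.
  move=> i _; case: (t.1) ss' {gt} => [|j|j|j] /=.
  + by move=> ss'; apply: unchanged_run => //; rewrite ss'.
  + move=> ss'; case: eqP => [ij|/eqP ij].
      by apply: incremented_run => //; rewrite ss' ij upd_eq.
    by apply: unchanged_run => //; rewrite ss' upd_neq.
  + move=> [sj ss']; case: eqP => [ij|/eqP ij].
      by apply: incremented_run => //; rewrite ss' ij upd_eq prednK.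
    by apply: unchanged_run => //; rewrite ss' upd_neq.
  by move=> [_ ss']; apply: unchanged_run => //; rewrite ss'.
- move=> [i _ /in_state_special//|[k s] ks].
  move=> /(in_state_run ks (mem_head _ _)) ek; rewrite -ek in ks.
  by case: ks => _; apply; exists s.
have c0_state : [:: c0] \in states c0.
  by rewrite inE; case: (c0) => *; rewrite mem_head orbT.
have ks : alive [:: c0] (input n).
  by split=> // -[_ [s ns _]]; apply: Nhalt; exists s.
have n0 : input n 0 = n by apply: upd_eq.
exists (inr ([:: c0], input n)); split=> //; rewrite !at_least_root // n0 ltnn.
split=> //; split; first exact/(in_state_run ks).
by move=> i; rewrite mem_iota at_least_root // /input => i0; rewrite upd_neq; lia.
Qed.

End Model.

(** * Reduction of halting to membership in the logic *)

Section Reduction.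

Variables (W : Type) (lt R : W -> W -> Prop).
Hypothesis lt_order : strict_linear_order lt.
Hypothesis lt_sub_R : forall u v, lt u v -> R u v.
Hypothesis R_sub_le : forall u v, R u v -> lt u v \/ u = v.
Variables (x y P p : nat) (x_neq_y : x <> y).

Lemma linear_trans u v w : R u v -> R v w -> R u w.
Proof.
have [_ trans _] := lt_order => /R_sub_le[uv|->//] /R_sub_le[vw|<-].
  by apply/lt_sub_R/(trans u v w).
exact: lt_sub_R.
Qed.

Lemma halting_logic_exp c n s :
  cmd_sem c (input n) s -> logic_exp R (Neg (run x y P p c (max_reg c) n)).
Proof.
move=> cs F I w g _ /(sat_run _ _ _ x_neq_y) w_run.
exact: (run_not_halting linear_trans w_run (leqnn _) cs).
Qed.

Lemma nonhalting_logic_const (ch : nat -> W) c m n :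
  (forall i, lt (ch i) (ch i.+1)) ->
  ~ (exists s, cmd_sem c (input n) s) ->
  ~ logic_const R (Neg (run x y P p c m n)).
Proof.
move=> ch_step Nc valid.
pose dom (_ : W) := @model_dom c.
have dom_ne w : exists d, dom w d by exists (inl 0).
pose F := PredFrame dom_ne (fun w v (_ : R w v) d (wd : dom w d) => wd : dom v d).
(* All proposition letters are interpreted alike, and so are all monadic letters, so [p] and [P] can
   be any indices. *)
pose holds (w : W) (k _ : nat) : k.-tuple (carrier F) -> Prop :=
  match k with
  | 0 => fun _ => model_mk ch w
  | 1 => fun a => model_pr ch c w (thead a)
  | _ => fun _ => False
  end.
have holds_dom w k l (a : k.-tuple (carrier F)) :
    holds w k l a -> forall i : 'I_k, Defs.dom F w (tnth a i).
  by case: k a => [a _ []|[a [da _] i|]] //; rewrite (ord1 i).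
pose I := Interpretation holds_dom.
apply: (valid F _ I (ch 0) (fun=> inl 0)) => //.
by apply/(sat_run _ _ _ x_neq_y); apply: (run_model lt_order).
Qed.

End Reduction.

Theorem theorem4 (W : Type) (lt R : W -> W -> Prop) (L : form -> Prop)
  (lt_order : strict_linear_order lt)
  (lt_chain : exists c : nat -> W, forall i, lt (c i) (c i.+1))
  (lt_sub_R : forall u v, lt u v -> R u v)
  (R_sub_le : forall u v, R u v -> lt u v \/ u = v)
  (exp_sub_L : forall A, logic_exp R A -> L A)
  (L_sub_const : forall A, L A -> logic_const R A)
  (x y : nat) (x_neq_y : x <> y) (P p : nat) :
  Pi1_hard (fun A => in_fragment x y P p A /\ satisfiable_for L A) /\
  Sigma1_hard (fun A => in_fragment x y P p A /\ L A).
Proof.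
have [ch ch_step] := lt_chain.
(* The two bounds on [L] meet here: a terminating run refutes the formula in all models with
   expanding domains, and without one it holds in a model with a constant domain. *)
have L_run c n : L (Neg (run x y P p c (max_reg c) n)) <->
    exists s, cmd_sem c (input n) s.
  split=> [/L_sub_const valid|[s /halting_logic_exp cs]]; last first.
    by apply/exp_sub_L/(cs _ lt).
  apply: NNPP => Nc.
  exact: (nonhalting_logic_const lt_order lt_sub_R R_sub_le x_neq_y ch_step Nc
    valid).
split=> X [Q recQ QX].
  (* For a [Pi1] set the program searches for a counterexample, so membership means that it does not
     halt. *)
  have [c cQ] := search_program false recQ.
  exists (run x y P p c (max_reg c)); split; first exact: recursive_run.
  move=> n; rewrite QX /satisfiable_for L_run cQ; split=> [XQ|[_ NQ] m].
    by split=> [|[m]]; [apply: fragment_run|rewrite XQ].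
  by case QE: (Q n m) => //; case: NQ; exists m.
have [c cQ] := search_program true recQ.
exists (fun n => Neg (run x y P p c (max_reg c) n)).
split; first exact: recursive_Neg_run.
move=> n; rewrite QX L_run cQ; split=> [XQ|[]//]; split=> //.
exact/fragment_Neg/fragment_run.
Qed.
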